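(* Let $m\ge1$. The binary operations $*_0,\dots,*_m$ defined on $\mathbb K[\mathrm{Dy}^m]$ satisfy, for all $x,y,z\in\mathbb K[\mathrm{Dy}^m]$: 1. $x*_i(y*_jz)=(x*_iy)*_jz$ for $0\le i<j\le m$; 2. $x*_i(y*_0z+\dots+y*_iz)=(x*_iy+\dots+x*_my)*_iz$ for $0\le i\le m$.
   Context: $\mathbb K$ is a field. Fix $m\ge1$. An $m$-Dyck path of size $n$ is a path in $\mathbb R^2$ from $(0,0)$ to $(2nm,0)$ made of up steps $(m,m)$ and down steps $(1,-1)$, never going below the $x$-axis (so it has $n$ up steps). $\mathrm{Dy}_n^m$ is the set of those of size $n$, and $\mathbb K[\mathrm{Dy}^m]$ is the vector space with basis $\bigcup_{n\ge1}\mathrm{Dy}_n^m$. A down step has level $k$ if the last up step before it is the $k$-th up step from the left; $L_k(P)$ is the number of down steps of level $k$, and $L(P):=L_n(P)$ for $P$ of size $n$. A path is determined by, and written as, $((L_1(P),\dots,L_{n-1}(P),L(P)))$. Concatenations: for $P$ of size $n$, $Q$ of size $r$, $0\le i\le L(P)$, $P\times_iQ:=((L_1(P),\dots,L_{n-1}(P),L(P)-i,L_1(Q),\dots,L_{r-1}(Q),L(Q)+i))$. A path is prime if it is not of the form $Q\times_0R$ with $Q,R$ of size $\ge1$. Every path of size $\ge 1$ is uniquely $Q_1\times_0\dots\times_0Q_r$ with all $Q_j$ prime of size $\geq 1$. Standard coloring $\alpha_P$ from the down steps of $P$ to $\{1,\dots,n\}$: write uniquely $P=u\,P_0\,d\,P_1\,d\cdots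 d\,P_m$, where $u$ is the first up step, the $m$ displayed $d$ are down steps, and $P_j$ is a (possibly empty, translated) $m$-Dyck path of size $n_j$; then $\alpha_P=1$ on the displayed down steps and $\alpha_P(d)=\alpha_{P_j}(d)+n_0+\dots+n_{j-1}+1$ for $d$ in $P_j$. For $P$ of size $n$, $\omega_n^P$ is the word of colors of the down steps of level $n$, read left to right (length $L(P)$). Let $\Lambda_r(P)$ be the set of $\lambda=(\lambda_0,\dots,\lambda_r)$ of non-negative integers with sum $L(P)$, and $\Lambda_r^i(P)$ ($0\le i\le m$) the subset of those $\lambda$ such that in the word formed by the last $\lambda_r$ letters of $\omega_n^P$ every color appears at most $i$ times and some integer of $\{1,\dots,n\}$ appears exactly $i$ times (so $\lambda\in\Lambda_r^0(P)$ iff $\lambda_r=0$). For $Q=Q_1\times_0\dots\times_0Q_r$ with $Q_j$ prime and $\lambda\in\Lambda_r(P)$, $$P*_\lambda Q:=(\cdots((P\times_{\lambda_1+\dots+\lambda_r}Q_1)\times_{\lambda_2+\dots+\lambda_r}Q_2)\cdots)\times_{\lambda_r}Q_r .$$ Finally $P*_jQ:=\sum_{\lambda\in\Lambda_r^j(P)}P*_\lambda Q$ for $0\le j\le m$, extended bilinearly to $\mathbb K[\mathrm{Dy}^m]$. *)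

(* Defs.v *)
From HB Require Import structures.
From mathcomp Require Import all_boot all_order all_algebra.
From mathcomp Require Import finmap.
From mathcomp Require Import zify.
From mathcomp.multinomials Require Import monalg.

Set Implicit Arguments.
Unset Strict Implicit.
Unset Printing Implicit Defensive.

Import GRing.Theory Num.Theory.

Inductive step := Up | Down.

Definition bool_of_step (s : step) : bool := if s is Up then true else false.
Definition step_of_bool (b : bool) : step := if b then Up else Down.
Lemma bool_of_stepK : cancel bool_of_step step_of_bool. Proof. by case. Qed.
HB.instance Definition _ := Countable.copy step (can_type bool_of_stepK).

Definition nup (w : seq step) : nat := count_mem Up w.
Definition ndown (w : seq step) : nat := count_mem Down w.

Definition step_vec (m : nat) (s : step) : int * int :=
  if s is Up then (m%:Z, m%:Z)%R else (1, -1)%R.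

Definition endpoint (m : nat) (w : seq step) : int * int :=
  (\sum_(s <- w) step_vec m s)%R.

(* The path [w] from (0,0) is an m-Dyck path of size [n]; each step being a
   segment, staying above the axis only has to be checked at the vertices.
   The size [n = 0] (empty path) is allowed here. *)
Definition is_dyck (m n : nat) (w : seq step) : bool :=
  (endpoint m w == ((2 * n * m)%N%:Z, 0))%R &&
  all (fun k => 0 <= (endpoint m (take k w)).2)%R (iota 0 (size w).+1).

(* The union of the Dy_n^m for n >= 1; an m-Dyck path of size n has n up
   steps when m >= 1, so its size is recovered as [nup w]. *)
Record dyck (m : nat) := Dyck {
  word :> seq step;
  _ : (0 < nup word) && is_dyck m (nup word) word }.

HB.instance Definition _ m := [isSub for @word m].
HB.instance Definition _ m := [Choice of dyck m by <:].

(* Levels of the down steps of [w], from left to right, when [k] up steps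
   precede [w]. *)
Fixpoint down_levels (k : nat) (w : seq step) : seq nat :=
  match w with
  | [::] => [::]
  | Up :: w' => down_levels k.+1 w'
  | Down :: w' => k :: down_levels k w'
  end.

Definition level (k : nat) (w : seq step) : nat := count_mem k (down_levels 0 w).
Definition last_level (w : seq step) : nat := level (nup w) w.

Definition of_levels (l : seq nat) : seq step :=
  flatten [seq Up :: nseq k Down | k <- l].

Definition wcat (P : seq step) (i : nat) (Q : seq step) : seq step :=
  of_levels ([seq level k P | k <- iota 1 (nup P).-1]
    ++ (last_level P - i)%N :: [seq level k Q | k <- iota 1 (nup Q).-1]
    ++ [:: (last_level Q + i)%N]).

Lemma nup_cat a b : nup (a ++ b) = (nup a + nup b)%N.
Proof. exact: count_cat. Qed.

Lemma ndown_cat a b : ndown (a ++ b) = (ndown a + ndown b)%N.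
Proof. exact: count_cat. Qed.

Lemma endpointE m w :
  endpoint m w =
  ((m * nup w + ndown w)%N%:Z, (m * nup w)%N%:Z - (ndown w)%:Z)%R.
Proof.
rewrite /endpoint; elim: w => [|s w IH]; first by rewrite big_nil muln0.
rewrite big_cons IH; case: s; rewrite /step_vec /nup /ndown /=;
  congr pair; rewrite /= ?mulnDr ?muln1 ?add0n ?add1n ?PoszD ?intS; lia.
Qed.

(* Final height of the walk [w] started at height [h], provided it never goes
   below the axis. *)
Fixpoint walk (m h : nat) (w : seq step) : option nat :=
  match w with
  | [::] => Some h
  | Up :: w' => walk m (h + m) w'
  | Down :: w' => if h is h'.+1 then walk m h' w' else None
  end.

Lemma walk_cat m h a b :
  walk m h (a ++ b) = obind (fun k => walk m k b) (walk m h a).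
Proof. by elim: a h => [|[] a IH] [|h] //=. Qed.

Lemma walk_addl m h j k w : walk m h w = Some k -> walk m (j + h) w = Some (j + k)%N.
Proof.
elim: w h => [|[] w IH] h /=; first by case=> ->.
- by rewrite -addnA; apply: IH.
- by case: h => // h; rewrite addnS; apply: IH.
Qed.

Lemma walk_size m h k w :
  walk m h w = Some k -> (k + ndown w = h + m * nup w)%N.
Proof.
elim: w h => [|[] w IH] h /=; first by case=> ->; rewrite muln0.
- by move=> /IH; rewrite /nup /ndown /= mulnDr; lia.
- by case: h => // h /IH; rewrite /nup /ndown /=; lia.
Qed.

Lemma walkP m h w :
  reflect (forall k, k <= size w -> ndown (take k w) <= h + m * nup (take k w))%N
          (walk m h w != None).
Proof.
apply: (iffP idP); elim: w h => [|s w IH] h.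
- by move=> _ [].
- case: s => /= [/IH H|].
  + case=> [//|k] /H; rewrite /nup /ndown /= mulnDr; lia.
  + case: h => [|h] // /IH H [//|k] /H; rewrite /nup /ndown /=; lia.
- by [].
- case: s => /= H.
  + apply: IH => k lek; have := H k.+1 lek; rewrite /nup /ndown /= mulnDr; lia.
  + case: h H => [|h] H; first by have := H 1%N isT; rewrite /= take0 /nup /ndown /=; lia.
    apply: IH => k lek; have := H k.+1 lek; rewrite /nup /ndown /=; lia.
Qed.

Lemma is_dyck_walk m n w :
  is_dyck m n w = (m * nup w == n * m)%N && (walk m 0 w == Some 0).
Proof.
have -> : is_dyck m n w =
    [&& (m * nup w == n * m)%N, ndown w == (m * nup w)%N & walk m 0 w != None].
  rewrite /is_dyck endpointE xpair_eqE andbA; congr andb.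
    by apply/idP/idP; lia.
  apply/allP/walkP => [H k lek|H k].
    by have := H k; rewrite mem_iota endpointE /=; lia.
  by rewrite mem_iota => lek; rewrite endpointE /=; have := H k; lia.
case: (walk m 0 w) ((@walk_size m 0)^~ w) => [k|] H; last by rewrite !andbF.
congr andb; rewrite andbT; have := H k erefl.
rewrite (inj_eq Some_inj); lia.
Qed.

Lemma is_dyckE m n w : (0 < m)%N ->
  is_dyck m n w = (nup w == n) && (walk m 0 w == Some 0).
Proof. by move=> m0; rewrite is_dyck_walk mulnC eqn_pmul2r. Qed.

Lemma is_dyck_nup m w : is_dyck m (nup w) w = (walk m 0 w == Some 0).
Proof. by rewrite is_dyck_walk mulnC eqxx. Qed.

Lemma dyck_wordP m (P : dyck m) : ((0 < nup P)%N * (walk m 0 P = Some 0))%type.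
Proof. by case: P => w /=; rewrite is_dyck_nup => /andP[? /eqP]. Qed.

Lemma down_levels_cat k a b :
  down_levels k (a ++ b) = down_levels k a ++ down_levels (k + nup a) b.
Proof.
elim: a k => [|[] a IH] k; rewrite ?addn0 //= IH /nup /=.
- by rewrite addnA addn1.
- by rewrite add0n.
Qed.

Lemma down_levels_Down k i : down_levels k (nseq i Down) = nseq i k.
Proof. by elim: i => //= i ->. Qed.

Lemma of_levels_cat s t : of_levels (s ++ t) = of_levels s ++ of_levels t.
Proof. by rewrite /of_levels map_cat flatten_cat. Qed.

Lemma nup_Down i : nup (nseq i Down) = 0.
Proof. by rewrite /nup count_nseq. Qed.

Lemma nup_of_levels s : nup (of_levels s) = size s.
Proof.
elim: s => // k s IH; rewrite -cat1s of_levels_cat nup_cat IH.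
by rewrite /of_levels /nup /= cats0 count_nseq.
Qed.

Lemma down_levels_of_levels k s :
  down_levels k (of_levels s) = flatten [seq nseq p.2 p.1 | p <- zip (iota k.+1 (size s)) s].
Proof.
elim: s k => // l s IH k; rewrite -cat1s of_levels_cat down_levels_cat IH.
by rewrite /of_levels /= cats0 down_levels_Down /nup /= count_nseq addn0 addn1.
Qed.

Lemma level_of_levels s k : level k (of_levels s) = nth 0 (0 :: s) k.
Proof.
rewrite /level down_levels_of_levels.
have H j : count_mem k (flatten [seq nseq p.2 p.1 | p <- zip (iota j.+1 (size s)) s])
    = if (k <= j)%N then 0 else nth 0 s (k - j.+1).
  elim: s j => [|l s IH] j /=; first by rewrite nth_nil; case: ifP.
  rewrite count_cat count_nseq IH /=.
  case: (ltngtP k j.+1) => [lt|gt|->].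
  - by rewrite -ltnS lt mul0n.
  - by rewrite leqNgt (ltnW gt) /= mul0n -[in RHS]subnSK.
  - by rewrite ltnn subnn mul1n addn0.
by rewrite H; case: k {H} => //= k; rewrite subn1.
Qed.

Lemma levels_of_levels s : [seq level k (of_levels s) | k <- iota 1 (size s)] = s.
Proof.
apply: (@eq_from_nth _ 0); first by rewrite size_map size_iota.
move=> i; rewrite size_map size_iota => lti.
by rewrite (nth_map 0) ?size_iota // nth_iota // level_of_levels.
Qed.

Lemma of_levels_ex w : exists i s, w = nseq i Down ++ of_levels s.
Proof.
elim: w => [|[] w [i [s ->]]]; first by exists 0, [::].
- by exists 0, (i :: s); rewrite /of_levels.
- by exists i.+1, s.
Qed.

(* [P x_i Q] inserts [Q] before the last [i] down steps of [P] *)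
Lemma wcat_of_levels s l i t k :
  wcat (of_levels (rcons s l)) i (of_levels (rcons t k)) =
  of_levels (s ++ (l - i)%N :: rcons t (k + i)%N).
Proof.
have E s' l' : [seq level j (of_levels (rcons s' l')) | j <- iota 1 (size s')] = s'.
  have := levels_of_levels (rcons s' l').
  by rewrite size_rcons -[(size s').+1]addn1 iotaD map_cat /= cats1 => /rcons_inj[].
have F s' l' : last_level (of_levels (rcons s' l')) = l'.
  by rewrite /last_level nup_of_levels size_rcons level_of_levels /= nth_rcons ltnn eqxx.
by rewrite /wcat !nup_of_levels !size_rcons /= !E !F cats1.
Qed.

Lemma walk_of_levels m w : walk m 0 w = Some 0 -> (0 < nup w)%N ->
  exists s l, w = of_levels (rcons s l).
Proof.
have [[|i] [s ->]] := of_levels_ex w => //.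
case/lastP: s => [|s l] // _ _; by exists s, l.
Qed.

Lemma of_levels_rcons s l : of_levels (rcons s l) = of_levels s ++ Up :: nseq l Down.
Proof. by rewrite -cats1 of_levels_cat /of_levels /= cats0. Qed.

Lemma walk_Down m h i : walk m h (nseq i Down) = if (i <= h)%N then Some (h - i)%N else None.
Proof. by elim: i h => [|i IH] [|h] //=; rewrite ?subn0 // IH. Qed.

Lemma wcatE m (P Q : dyck m) i : (i <= last_level P)%N ->
  exists A, word P = A ++ nseq i Down /\ wcat P i Q = A ++ Q ++ nseq i Down.
Proof.
have [[P0 wP] [Q0 wQ]] := (dyck_wordP P, dyck_wordP Q).
have [s [l EP]] := walk_of_levels wP P0.
have [t [k EQ]] := walk_of_levels wQ Q0.
have -> : last_level P = l.
  by rewrite EP /last_level nup_of_levels size_rcons level_of_levels /= nth_rcons ltnn eqxx.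
move=> le_il; exists (of_levels s ++ Up :: nseq (l - i) Down).
rewrite EP EQ wcat_of_levels !of_levels_rcons -!catA /=; split.
  by rewrite -nseqD subnK.
rewrite of_levels_cat; congr (_ ++ _); rewrite -[_ :: rcons _ _]cat1s of_levels_cat.
by rewrite of_levels_rcons nseqD /of_levels /= cats0.
Qed.

Lemma wcat_dyck m (P Q : dyck m) i : (i <= last_level P)%N ->
  (0 < nup (wcat P i Q))%N && is_dyck m (nup (wcat P i Q)) (wcat P i Q).
Proof.
have [[P0 wP] [Q0 wQ]] := (dyck_wordP P, dyck_wordP Q).
move=> /(wcatE Q)[A [EP ->]]; rewrite is_dyck_nup !nup_cat addnCA addn_gt0 Q0 /=.
move: wP; rewrite EP !walk_cat; case: (walk m 0 A) => //= h.
have := @walk_addl m 0 h 0 Q wQ; rewrite addn0 walk_cat => -> /=.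
by move=> ->.
Qed.

(* [P x_i Q], only meaningful for [i <= last_level P], see [word_dcat]. *)
Definition dcat m (P : dyck m) (i : nat) (Q : dyck m) : dyck m :=
  insubd P (wcat P i Q).

Lemma word_dcat m (P Q : dyck m) i : (i <= last_level P)%N ->
  word (dcat P i Q) = wcat P i Q.
Proof. by move=> le_i; apply: insubdK; apply: wcat_dyck. Qed.

Lemma word_dcat0 m (P Q : dyck m) : word (dcat P 0 Q) = word P ++ word Q.
Proof.
by rewrite word_dcat //; have [A [-> ->]] := @wcatE m P Q 0 isT; rewrite !cats0.
Qed.

Lemma last_level_dcat m (P Q : dyck m) i : (i <= last_level P)%N ->
  last_level (dcat P i Q) = (last_level Q + i)%N.
Proof.
move=> le_i; rewrite word_dcat //.
have [[P0 wP] [Q0 wQ]] := (dyck_wordP P, dyck_wordP Q).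
have [s [l EP]] := walk_of_levels wP P0.
have [t [k EQ]] := walk_of_levels wQ Q0.
have F s' l' : last_level (of_levels (rcons s' l')) = l'.
  by rewrite /last_level nup_of_levels size_rcons level_of_levels /= nth_rcons ltnn eqxx.
by rewrite EP EQ wcat_of_levels -rcons_cons -rcons_cat !F.
Qed.

Definition is_prime m (P : dyck m) : Prop :=
  forall Q R : dyck m, P <> dcat Q 0 R.

Definition prime_decomp m (P : dyck m) (s : seq (dyck m)) : Prop :=
  (forall Q, Q \in s -> is_prime Q) /\
  (if s is Q :: s' then foldl (fun A B => dcat A 0 B) Q s' = P else False).

(* The unique prime decomposition, see [prime_factorsP] and
   [prime_decomp_unique]: repeatedly cut off the shortest nonempty prefix that is a Dyck path; the
   [fuel] only has to bound the length of [w]. *)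
Fixpoint prime_words (fuel m : nat) (w : seq step) : seq (seq step) :=
  match fuel, w with
  | fuel'.+1, _ :: _ =>
    let k := (find (fun k => is_dyck m (nup (take k.+1 w)) (take k.+1 w))
                (iota 0 (size w))).+1 in
    take k w :: prime_words fuel' m (drop k w)
  | _, _ => [::]
  end.

Definition prime_factors m (P : dyck m) : seq (dyck m) :=
  pmap insub (prime_words (size P) m P).

Lemma walk_nup m w : walk m 0 w = Some 0 -> w != [::] -> (0 < nup w)%N.
Proof.
move=> /walk_size; case: w => // [[] w]; rewrite /nup /ndown //=.
by case: (count_mem Up w) => //; rewrite !add0n muln0; lia.
Qed.

Lemma word_neq0 m (P : dyck m) : word P != [::].
Proof. by have [] := dyck_wordP P; case: (word P). Qed.

Lemma word_foldl m (Q : dyck m) s :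
  word (foldl (fun A B => dcat A 0 B) Q s) = flatten (map (@word m) (Q :: s)).
Proof.
elim: s Q => [|R s IH] Q; first by rewrite /= cats0.
by rewrite [LHS]IH /= word_dcat0 catA.
Qed.

Lemma walk_drop m w k : walk m 0 (take k w) = Some 0 ->
  walk m 0 w = Some 0 -> walk m 0 (drop k w) = Some 0.
Proof. by move=> Hk; rewrite -{1}(cat_take_drop k w) walk_cat Hk. Qed.

Lemma prime_words_correct fuel m w :
  (size w <= fuel)%N -> walk m 0 w = Some 0 ->
  let s : seq (dyck m) := pmap insub (prime_words fuel m w) in
  (forall Q, Q \in s -> is_prime Q) /\ flatten (map (@word m) s) = w.
Proof.
elim: fuel w => [|fuel IH] w; first by case: w.
have [->//|w0] := eqVneq w [::].
move=> szw ww.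
have -> : prime_words fuel.+1 m w =
    let k := (find (fun k => is_dyck m (nup (take k.+1 w)) (take k.+1 w))
                (iota 0 (size w))).+1 in
    take k w :: prime_words fuel m (drop k w) by case: (w) w0.
set p := fun k => is_dyck _ _ _; set k := find p _ => /=.
have sz0 : (0 < size w)%N by case: (w) w0.
have hp : has p (iota 0 (size w)).
  apply/hasP; exists (size w).-1; first by rewrite mem_iota add0n ltn_predL.
  by rewrite /p prednK // take_size is_dyck_nup ww.
have kw : (k < size w)%N by move: hp; rewrite has_find size_iota.
have wk : walk m 0 (take k.+1 w) = Some 0.
  by have := nth_find 0 hp; rewrite -/k nth_iota // add0n /p is_dyck_nup => /eqP.
have mink j : (j < k)%N -> walk m 0 (take j.+1 w) != Some 0.
  move=> jk; have := before_find 0 jk.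
  by rewrite nth_iota ?(ltn_trans jk) // add0n /p is_dyck_nup => ->.
have tk0 : take k.+1 w != [::] by case: (w) w0.
have Pk : (0 < nup (take k.+1 w))%N && is_dyck m (nup (take k.+1 w)) (take k.+1 w).
  by rewrite is_dyck_nup wk eqxx (walk_nup wk).
have szd : (size (drop k.+1 w) <= fuel)%N by rewrite size_drop; lia.
have [H1 H2] := IH _ szd (walk_drop wk ww).
rewrite insubT /= H2 cat_take_drop; split=> // Q.
rewrite inE => /orP[/eqP-> {Q}|]; last exact: H1.
move=> Q R E; have := congr1 (@word m) E; rewrite word_dcat0 /= => {}E.
have szE := congr1 size E; rewrite size_cat size_takel // in szE.
have [Q0 R0] : (0 < size Q)%N /\ (0 < size R)%N.
  by rewrite !lt0n !size_eq0 !word_neq0.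
have /negP[] : walk m 0 (take (size Q).-1.+1 w) != Some 0 by apply: mink; lia.
rewrite prednK // -[take _ w](@take_takel _ _ k.+1); last by lia.
by rewrite E take_size_cat // (dyck_wordP Q).2.
Qed.

Lemma prime_factorsP m (P : dyck m) : prime_decomp P (prime_factors P).
Proof.
have [H1 H2] := prime_words_correct (leqnn _) (dyck_wordP P).2.
split; first exact: H1.
rewrite /prime_factors; case: (pmap _ _) H2 => [/esym/eqP|Q s H].
  by rewrite (negPf (word_neq0 P)).
by apply: val_inj; rewrite /= word_foldl.
Qed.

Lemma prime_decomp_unique m (P : dyck m) s t :
  prime_decomp P s -> prime_decomp P t -> s = t.
Proof.
have H u : prime_decomp P u ->
    (forall Q, Q \in u -> is_prime Q) /\ flatten (map (@word m) u) = P.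
  by case: u => [[]//|Q u] [? <-]; rewrite word_foldl.
move=> /H[ps Es] /H[pt Et]; move: Es; rewrite -{}Et {H P}.
elim: s t ps pt => [|Q s IH] [|R t] //= ps pt E.
- by have := word_neq0 R; case: (word R) E.
- by have := word_neq0 Q; case: (word Q) E.
have aux (A B : dyck m) u v : is_prime B -> (size A <= size B)%N ->
    word A ++ u = word B ++ v -> A = B.
  move=> pB le_AB EAB; have [B0 wB] := dyck_wordP B; have [A0 wA] := dyck_wordP A.
  have EA : take (size A) B = A.
    by have := congr1 (take (size A)) EAB; rewrite take_size_cat // takel_cat.
  have [r0|r0] := eqVneq (drop (size A) B) [::].
    by apply: val_inj; rewrite /= -[in RHS](cat_take_drop (size A) B) r0 EA cats0.
  have wr : walk m 0 (drop (size A) B) = Some 0 by apply: walk_drop; rewrite ?EA.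
  have Pr : (0 < nup (drop (size A) B))%N &&
      is_dyck m (nup (drop (size A) B)) (drop (size A) B).
    by rewrite is_dyck_nup wr eqxx (walk_nup wr).
  by case: (pB A (Dyck Pr)); apply: val_inj; rewrite /= word_dcat0 /= -{1}EA cat_take_drop.
have EQR : Q = R.
  case/orP: (leq_total (size Q) (size R)) => le.
    by apply: aux E => //; apply: pt; rewrite mem_head.
  by apply/esym; apply: aux (esym E) => //; apply: ps; rewrite mem_head.
congr cons => //; apply: IH.
- by move=> A As; apply: ps; rewrite inE As orbT.
- by move=> A At; apply: pt; rewrite inE At orbT.
- by move/eqP: E; rewrite EQR eqseq_cat // eqxx => /eqP.
Qed.

(* [cut m 0 w] splits [w] at its first down step ending below the axis, which
   is removed: it maps [P0 ++ Down :: w'] to [(P0, w')] if [P0] is Dyck. *)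
Fixpoint cut (m h : nat) (w : seq step) : seq step * seq step :=
  match w with
  | [::] => ([::], [::])
  | Up :: w' => let: (a, b) := cut m (h + m) w' in (Up :: a, b)
  | Down :: w' =>
    if h is h'.+1 then let: (a, b) := cut m h' w' in (Down :: a, b)
    else ([::], w')
  end.

(* [pieces m k (P0 d P1 d ... d Pk)] is [:: P0; P1; ...; Pk] *)
Fixpoint pieces (m k : nat) (w : seq step) : seq (seq step) :=
  if k is k'.+1 then (cut m 0 w).1 :: pieces m k' (cut m 0 w).2 else [:: w].

Definition unpieces (Ps : seq (seq step)) : seq step :=
  head [::] Ps ++ flatten [seq Down :: P | P <- behead Ps].

(* Colors of the down steps of [P0 d P1 d ... d Pm], the down steps of each
   [Pj] being colored by [col]. *)
Definition color_pieces (col : seq step -> seq nat) (Ps : seq (seq step)) : seq nat :=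
  flatten [seq (if j is 0 then [::] else [:: 1%N]) ++
               [seq (c + sumn [seq nup P | P <- take j Ps] + 1)%N
               | c <- col (nth [::] Ps j)]
          | j <- iota 0 (size Ps)].

Fixpoint color_rec (fuel m : nat) (w : seq step) : seq nat :=
  match fuel, w with
  | fuel'.+1, Up :: w' => color_pieces (color_rec fuel' m) (pieces m m w')
  | _, _ => [::]
  end.

(* The standard coloring, as the word of colors of the down steps of [w] from
   left to right; its defining recursion is [std_coloringE]. *)
Definition std_coloring (m : nat) (w : seq step) : seq nat :=
  color_rec (size w) m w.

Lemma cut_cat m h a k w : walk m h a = Some k ->
  cut m h (a ++ w) = (a ++ (cut m k w).1, (cut m k w).2).
Proof.
elim: a h => [|[] a IH] h /=; first by case=> ->; case: cut.
- by move=> /IH ->.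
- by case: h => // h /IH ->.
Qed.

Lemma unpieces_cons2 P Q Ps :
  unpieces (P :: Q :: Ps) = P ++ Down :: unpieces (Q :: Ps).
Proof. by []. Qed.

Lemma pieces_unpieces m Ps :
  all (fun P => is_dyck m (nup P) P) Ps -> (0 < size Ps)%N ->
  pieces m (size Ps).-1 (unpieces Ps) = Ps.
Proof.
elim: Ps => // P [|Q Ps] IH; first by rewrite /unpieces /= cats0.
case/andP; rewrite is_dyck_nup => /eqP wP dPs _; rewrite unpieces_cons2 /=.
by rewrite (cut_cat _ wP) /= cats0 IH.
Qed.

Lemma walk_cut m h j w : (j < h)%N -> walk m h w = Some j ->
  exists a b, [/\ w = a ++ Down :: b, walk m 0 a = Some 0 & walk m h.-1 b = Some j].
Proof.
have G n : forall i v, (size v < n)%N -> (j < i + h)%N -> (j < h)%N ->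
    walk m (i + h) v = Some j -> 
    exists a b, [/\ v = a ++ Down :: b, walk m i a = Some 0 & walk m h.-1 b = Some j].
  elim: n => // n IH i [|[] v] /= szv lt1 lt2.
  - by case=> E; lia.
  - rewrite addnAC => /IH[]//; first by lia.
    by move=> a [b [-> wa wb]]; exists (Up :: a), b.
  - case: i lt1 => [|i] lt1; rewrite ?addSn.
      by rewrite add0n; case: h lt1 lt2 {IH} => // h' _ _ wv; exists [::], v.
    move=> /IH[]//; first by lia.
    by move=> a [b [-> wa wb]]; exists (Down :: a), b.
by move=> lt; apply: (G (size w).+1 0) => //; rewrite add0n.
Qed.

Lemma walk_unpieces m k w : walk m k w = Some 0 ->
  exists Ps, [/\ size Ps = k.+1, all (fun P => is_dyck m (nup P) P) Ps
               & w = unpieces Ps].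
Proof.
elim: k w => [|k IH] w.
  move=> ww; exists [:: w]; split=> //=; first by rewrite is_dyck_nup ww eqxx.
  by rewrite /unpieces /= cats0.
case/walk_cut => // a [b [-> wa /IH[Ps [szPs dPs ->]]]].
exists (a :: Ps); split; rewrite /= ?szPs ?dPs ?is_dyck_nup ?wa ?eqxx //.
by case: Ps szPs {dPs}.
Qed.

Lemma dyck_pieces m w : is_dyck m (nup w) w -> w != [::] ->
  exists Ps, [/\ size Ps = m.+1, all (fun P => is_dyck m (nup P) P) Ps
               & w = Up :: unpieces Ps].
Proof.
rewrite is_dyck_nup; case: w => [|[] w] //= /eqP.
by rewrite add0n => /walk_unpieces[Ps [? ? ->]] _; exists Ps.
Qed.

Lemma size_cut m h w :
  (size (cut m h w).1 <= size w)%N /\ (size (cut m h w).2 <= size w)%N.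
Proof.
elim: w h => [|[] w IH] h //=.
- by have := IH (h + m)%N; case: cut => a b /=; lia.
- by case: h => [|h] //=; have := IH h; case: cut => a b /=; lia.
Qed.

Lemma size_pieces m k w i : (size (nth [::] (pieces m k w) i) <= size w)%N.
Proof.
elim: k w i => [|k IH] w [|i] //=; rewrite ?nth_nil //.
- by have [] := size_cut m 0 w.
- by apply: leq_trans (IH _ _) _; have [] := size_cut m 0 w.
Qed.

Lemma eq_color_pieces c1 c2 Ps : (forall i, c1 (nth [::] Ps i) = c2 (nth [::] Ps i)) ->
  color_pieces c1 Ps = color_pieces c2 Ps.
Proof. by move=> H; rewrite /color_pieces; congr flatten; apply: eq_map => j; rewrite H. Qed.

Lemma color_rec_fuel m f g w : (size w <= f)%N -> (size w <= g)%N ->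
  color_rec f m w = color_rec g m w.
Proof.
elim: f g w => [|f IH] [|g] [|[] w] //= lef leg.
by apply: eq_color_pieces => i; apply: IH; apply: leq_trans (size_pieces _ _ _ _) _.
Qed.

Lemma std_coloringE m Ps : size Ps = m.+1 ->
  all (fun P => is_dyck m (nup P) P) Ps ->
  std_coloring m (Up :: unpieces Ps) = color_pieces (std_coloring m) Ps.
Proof.
move=> szPs dPs; have E : pieces m m (unpieces Ps) = Ps.
  by have := pieces_unpieces dPs; rewrite szPs; apply.
rewrite /std_coloring /= E; apply: eq_color_pieces => i.
by apply: color_rec_fuel; rewrite // -{1}E size_pieces.
Qed.

Lemma ndown_unpieces Ps : (0 < size Ps)%N ->
  ndown (unpieces Ps) = (sumn (map ndown Ps) + (size Ps).-1)%N.
Proof.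
elim: Ps => // P [|Q Ps] IH _; first by rewrite /unpieces /= cats0 !addn0.
rewrite unpieces_cons2 ndown_cat -[Down :: _]cat1s ndown_cat IH //=.
by lia.
Qed.

Lemma size_std_coloring m w : is_dyck m (nup w) w ->
  size (std_coloring m w) = ndown w.
Proof.
move: (leqnn (size w)); move: {2}(size w) => n.
elim: n w => [|n IH] w; first by case: w.
move=> szw dw; have [->//|w0] := eqVneq w [::].
have [Ps [szPs dPs Ew]] := dyck_pieces dw w0.
have szu i : (size (nth [::] Ps i) <= size (unpieces Ps))%N.
  by have := pieces_unpieces dPs; rewrite szPs => /(_ isT)/= {1}<-; apply: size_pieces.
rewrite Ew std_coloringE //.
rewrite -[Up :: _]cat1s ndown_cat ndown_unpieces ?szPs // add0n.
rewrite /color_pieces size_flatten /shape -map_comp sumnE big_map szPs.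
rewrite [sumn _]sumnE big_map (big_nth [::]) szPs.
have -> : iota 0 m.+1 = index_iota 0 m.+1 by rewrite /index_iota subn0.
rewrite [in LHS]big_ltn // [in RHS]big_ltn //= size_map.
have IHi i : (i < m.+1)%N -> size (std_coloring m (nth [::] Ps i)) = ndown (nth [::] Ps i).
  move=> lti; apply: IH; last by apply: (allP dPs); rewrite mem_nth ?szPs.
  by rewrite -ltnS; apply: leq_trans szw; rewrite Ew ltnS szu.
rewrite IHi // -addnA; congr addn.
have Em : (\sum_(1 <= j < m.+1) 1 = m)%N by rewrite sum_nat_const_nat subn1 muln1.
apply: (@etrans _ _ (\sum_(1 <= j < m.+1) ndown (nth [::] Ps j) +
                     \sum_(1 <= j < m.+1) 1)%N); last by rewrite Em.
rewrite -big_split /= !big_nat; apply: eq_bigr => [[|j]] //= ltj.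
by rewrite size_map IHi // addn1.
Qed.

(* The word omega_n^w of colors of the down steps of level n, n the size *)
Definition last_colors (m : nat) (w : seq step) : seq nat :=
  [seq p.1 | p <- zip (std_coloring m w) (down_levels 0 w) & p.2 == nup w].

(* Since the entries of [lam] sum to [last_level P], each is at most
   [last_level P]. *)
Definition Lambda m (P : dyck m) (r : nat) : {set r.+1.-tuple 'I_(last_level P).+1} :=
  [set lam : r.+1.-tuple 'I_(last_level P).+1 |
    (\sum_(k < r.+1) tnth lam k == last_level P)%N].

Definition Lambda_i m (i : nat) (P : dyck m) (r : nat) :
    {set r.+1.-tuple 'I_(last_level P).+1} :=
  [set lam in Lambda P r |
    let omega := last_colors m P in
    let v := drop (size omega - tnth lam ord_max) omega in
    all (fun c => count_mem c v <= i)%N v &&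
    has (fun c => count_mem c v == i) (iota 1 (nup P))].

(* [ls] is the list [lambda_1, ..., lambda_r] and [Qs] the list [Q_1, ..., Q_r].
   If the sum of [ls] is at most [last_level P], then by [last_level_dcat] every
   [dcat] is taken at an admissible index. *)
Fixpoint insert_factors m (P : dyck m) (ls : seq nat) (Qs : seq (dyck m)) : dyck m :=
  if Qs is Q :: Qs' then insert_factors (dcat P (sumn ls) Q) (behead ls) Qs'
  else P.

Definition star_lam m (P : dyck m) (lam : seq nat) (Q : dyck m) : dyck m :=
  insert_factors P (behead lam) (prime_factors Q).

Local Open Scope ring_scope.

(* {malg K[dyck m]} is the K-vector space with basis << P >>, P : dyck m *)
Definition star_basis (K : fieldType) m (j : nat) (P Q : dyck m) : {malg K[dyck m]} :=
  \sum_(lam in Lambda_i j P (size (prime_factors Q)))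
     << star_lam P [seq nat_of_ord l | l <- lam] Q >>.

Definition star (K : fieldType) m (j : nat) (x y : {malg K[dyck m]}) :
    {malg K[dyck m]} :=
  \sum_(P <- msupp x) \sum_(Q <- msupp y) (x@_P * y@_Q) *: star_basis K j P Q.

(* Main.v *)
Require Import Defs.
From HB Require Import structures.
From mathcomp Require Import all_boot all_order all_algebra.
From mathcomp Require Import finmap zify.
From mathcomp.multinomials Require Import monalg.

(** The product [P *_lam Q] inserts the prime factors [Q_1, ..., Q_r] of [Q] into the
    final run of down steps of [P], at weakly decreasing positions [a_1 >= ... >= a_r]
    counted from the end (the tail sums of [lam]); the operation [*_i] selects the
    [lam] for which [mult P a_r = i], where [mult P a] is the largest multiplicity of
    a color among the last [a] steps of [P].

    Fix basis elements [P], [Q], [R] and put [h = a_r].  In [(P *_a Q) *_b R], the last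
    run consists of the last run of [Q] followed by the last [h] steps of [P].  The
    factors of [R] with [b_k > h] therefore go inside the last prime factor of [Q],
    which remains prime ([prime_dcat]), and those with [b_k <= h] go into the
    last run of [P], as if they were new prime factors.  This is the path
    [P *_(a ++ b') (Q *_c R)], where [c_k = b_k - h] (or 0) and [b'] lists the [b_k <= h]
    ([insert_insert]), and [(a, b) <-> (a, c, b')] is a bijection
    ([sum_descents_split]).

    It remains to compare the conditions on colors.  The coloring amounts to matching
    up and down steps with a stack ([std_coloring_popped]), so the last run of
    [P *_a Q] carries the colors of [Q], shifted beyond those of [P], followed by the last
    [h] colors of [P].  Hence its multiplicity at [b_s] is [mult P b_s] if [b_s <= h], and
    the maximum of [mult Q (b_s - h)] and [mult P h] otherwise ([mult_insert_low],
    [mult_insert_high]).  For the relations of the theorem, the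
    conditions on the two sides then agree for each triple, because [mult P] is
    monotone, vanishes at 0 and is bounded by [m].  [star_when_assoc]
    does this for arbitrary conditions on the multiplicities, and [bilin_ext_assoc]
    passes from basis elements to the whole space. *)

Set Implicit Arguments.
Unset Strict Implicit.
Unset Printing Implicit Defensive.

Import GRing.Theory.
Local Open Scope ring_scope.
(** * Sums over weakly decreasing sequences *)

(** Insertion positions: a composition [(lam_0, ..., lam_r)] of [L] is encoded
    by its tail sums [a_k = lam_k + ... + lam_r], a weakly decreasing sequence of
    length [r] bounded by [L].  The [a_k] are the indices of the successive
    concatenations in [P *_lam Q], and the last of them is [lam_r]. *)
Fixpoint descents (L r : nat) : seq (seq nat) :=
  if r is r'.+1 then [seq a :: s | a <- iota 0 L.+1, s <- descents a r']
  else [:: [::]].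

Lemma descentsS L r :
  descents L r.+1 = [seq a :: s | a <- iota 0 L.+1, s <- descents a r].
Proof. by []. Qed.

Lemma mem_descents L r a : (a \in descents L r) = (size a == r) && path geq L a.
Proof.
elim: r L a => [|r IH] L a; first by case: a.
rewrite descentsS; apply/allpairsPdep/idP => [[y [s [+ + ->]]]|].
  by rewrite mem_iota IH ltnS /= eqSS => -> /andP[-> ->].
case: a => // x a; rewrite /= eqSS => /and3P[sza lex pa]; exists x, a; split=> //.
  by rewrite -[_ :: _]/(iota 0 L.+1) mem_iota ltnS.
by rewrite IH sza.
Qed.

Lemma descents_uniq L r : uniq (descents L r).
Proof.
elim: r L => [|r IH] L //; rewrite descentsS.
apply: allpairs_uniq_dep; rewrite ?iota_uniq //.
by move=> [x s] [y t] _ _ [-> ->].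
Qed.

Lemma sum_descentsS (V : nmodType) L r (G : seq nat -> V) :
  \sum_(s <- descents L r.+1) G s =
  \sum_(0 <= a < L.+1) \sum_(s <- descents a r) G (a :: s).
Proof. by rewrite descentsS big_allpairs_dep /index_iota subn0. Qed.

Lemma sum_descents_cat (V : nmodType) L r k (G : seq nat -> V) :
  \sum_(s <- descents L (r + k)) G s =
  \sum_(a <- descents L r) \sum_(b <- descents (last L a) k) G (a ++ b).
Proof.
elim: r L G => [|r IH] L G; first by rewrite big_seq1.
rewrite addSn !sum_descentsS; apply: eq_bigr => x _.
by rewrite IH.
Qed.

Definition num_zeros (c : seq nat) : nat := count_mem 0%N c.
Definition raise (h : nat) (c : seq nat) : seq nat := [seq (x + h)%N | x <- c & x != 0%N].

(** The numerical bijection behind the theorem.  In a weakly decreasing [b] bounded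
    by [l + h], the entries above [h] come first; lowering them by [h] and padding
    with zeros gives a sequence [c] bounded by [l] of the same length, and the
    entries that do not exceed [h], one for each zero of [c], form an arbitrary
    weakly decreasing sequence bounded by [h]. *)
Lemma sum_descents_split (V : nmodType) l h s (G : seq nat -> V) :
  \sum_(b <- descents (l + h) s) G b =
  \sum_(c <- descents l s) \sum_(b <- descents h (num_zeros c)) G (raise h c ++ b).
Proof.
elim: s l G => [|s IH] l G; first by rewrite !big_seq1.
have D0 k : descents 0 k = [:: nseq k 0%N].
  by elim: k => //= k ->.
rewrite !sum_descentsS.
rewrite (big_cat_nat _ (n := h.+1)) //=; last by lia.
rewrite [RHS]big_nat_recl //; congr (_ + _).
  rewrite D0 big_seq1 /raise /num_zeros /= count_nseq filter_nseq.
  rewrite /= mul1n -sum_descentsS.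
  by [].
rewrite -[h.+1]add0n big_addn subSS addnK.
by apply: eq_bigr => x _; rewrite addnS -addSn IH.

Qed.

(** The composition with tail sums [a]; the inverse encoding. *)
Fixpoint gaps (L : nat) (a : seq nat) : seq nat :=
  if a is x :: a' then (L - x)%N :: gaps x a' else [:: L].

Lemma size_gaps L a : size (gaps L a) = (size a).+1.
Proof. by elim: a L => //= x a IH L; rewrite IH. Qed.

Lemma sumn_gaps L a : path geq L a -> sumn (gaps L a) = L.
Proof.
elim: a L => [|x a IH] L /=; first by rewrite addn0.
by case/andP=> lex /IH ->; rewrite subnK.
Qed.

Lemma last_gaps L x0 a : last x0 (gaps L a) = last L a.
Proof. by elim: a L x0 => //= x a IH L x0; rewrite IH. Qed.

Lemma gaps_surj u : u != [::] ->
  exists2 a, path geq (sumn u) a & gaps (sumn u) a = u.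
Proof.
elim: u => // x [|y u] IH _; first by exists [::]; rewrite //= addn0.
have [//|a pa ga] := IH; exists (sumn (y :: u) :: a).
  by rewrite [path _ _ _]/= pa andbT leq_addl.
by rewrite [gaps _ _]/= addnK; congr cons; rewrite -[in RHS]ga.
Qed.

Lemma gaps_inj L a b : path geq L a -> path geq L b -> gaps L a = gaps L b -> a = b.
Proof.
elim: a b L => [|x a IH] [|y b] L //=.
- by move=> _ _ []; case: b.
- by move=> _ _ []; case: a {IH}.
case/andP=> lx pa /andP[ly pb] [exy]; have {exy} exy : x = y by lia.
by rewrite -{y}exy in ly pb * => /IH-> .
Qed.

(** Re-indexes by tail sums the sums over tuples that define the products. *)
Lemma sum_compositions (V : nmodType) L r (C : pred nat) (F : seq nat -> V) :
  \sum_(lam : r.+1.-tuple 'I_L.+1 |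
      (\sum_(k < r.+1) tnth lam k == L)%N && C (tnth lam ord_max))
     F [seq nat_of_ord l | l <- lam] =
  \sum_(a <- descents L r | C (last L a)) F (gaps L a).
Proof.
pose valt (lam : r.+1.-tuple 'I_L.+1) := [seq nat_of_ord l | l <- lam].
have sumt (lam : r.+1.-tuple 'I_L.+1) : (\sum_(k < r.+1) tnth lam k)%N = sumn (valt lam).
  by rewrite /valt sumnE big_map big_tuple.
have lastt (lam : r.+1.-tuple 'I_L.+1) : nat_of_ord (tnth lam ord_max) = last 0%N (valt lam).
  by rewrite (tnth_nth ord0) -nth_last size_map size_tuple (nth_map ord0) ?size_tuple.
have -> : \sum_(a <- descents L r | C (last L a)) F (gaps L a) =
    \sum_(u <- [seq gaps L a | a <- descents L r & C (last L a)]) F u.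
  by rewrite big_map big_filter.
have -> : \sum_(lam : r.+1.-tuple 'I_L.+1 |
      (\sum_(k < r.+1) tnth lam k == L)%N && C (tnth lam ord_max)) F (valt lam) =
    \sum_(u <- [seq valt lam | lam <- index_enum (r.+1.-tuple 'I_L.+1) &
       (sumn (valt lam) == L) && C (last 0%N (valt lam))]) F u.
  rewrite big_map big_filter.
  by apply: eq_bigl => lam; rewrite sumt lastt.
apply: perm_big; apply: uniq_perm.
- rewrite map_inj_uniq ?filter_uniq ?index_enum_uniq //.
  by move=> l1 l2 /(inj_map val_inj) /val_inj.
- rewrite map_inj_in_uniq ?filter_uniq ?descents_uniq // => a b.
  rewrite !mem_filter !mem_descents => /and3P[_ _ pa] /and3P[_ _ pb].
  exact: gaps_inj.
move=> u; apply/mapP/mapP => [[lam]|[a]].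
  rewrite mem_filter => /andP[/andP[/eqP sl Cl] _] ->.
  have [|a pa ga] := @gaps_surj (valt lam); first by rewrite -size_eq0 size_map size_tuple.
  rewrite sl in pa ga; exists a => //.
  rewrite mem_filter mem_descents pa andbT -(last_gaps L 0%N a) ga Cl.
  by have := congr1 size ga; rewrite size_gaps size_map size_tuple => -[->] /=.
rewrite mem_filter mem_descents => /and3P[Ca /eqP sza pa] ->.
have szg : size [seq (inord x : 'I_L.+1) | x <- gaps L a] == r.+1.
  by rewrite size_map size_gaps sza.
have Eg : gaps L a = valt (Tuple szg).
  rewrite /valt /= -map_comp -[LHS]map_id; apply/eq_in_map => x xg /=.
  rewrite inordK // ltnS -(sumn_gaps pa).
  by have := perm_to_rem xg => /perm_sumn->; rewrite leq_addr.
exists (Tuple szg) => //.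
by rewrite mem_filter mem_index_enum andbT -Eg sumn_gaps // eqxx last_gaps.
Qed.

(** * Concatenation of paths and prime factors *)

Lemma down_levels_le k w : all (fun j => j <= k + nup w)%N (down_levels k w).
Proof.
elim: w k => [|[] w IH] k //=.
- by have := IH k.+1; rewrite /nup /= addnA addn1.
- by rewrite leq_addr; apply: IH.
Qed.

Lemma last_level_Up A l : last_level (A ++ Up :: nseq l Down) = l.
Proof.
rewrite /last_level /level down_levels_cat add0n /= down_levels_Down count_cat.
have -> : nup (A ++ Up :: nseq l Down) = (nup A).+1.
  by rewrite nup_cat /nup /= count_nseq /= addn1.
rewrite count_nseq /= eqxx mul1n (_ : count _ _ = 0%N) //.
apply/eqP; rewrite eqn0Ngt -has_count; apply/hasP => -[j jA /= /eqP Ej].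
by have := allP (down_levels_le 0 A) j jA; rewrite Ej add0n ltnn.
Qed.

Lemma dyck_last_run m (P : dyck m) :
  exists A, word P = A ++ Up :: nseq (last_level P) Down.
Proof.
have [P0 wP] := dyck_wordP P; have [s [l EP]] := walk_of_levels wP P0.
exists (of_levels s); move: EP; rewrite of_levels_rcons => EP.
by rewrite {2}EP last_level_Up.
Qed.

Lemma last_level_gt0 m (P : dyck m) : (0 < m)%N -> (0 < last_level P)%N.
Proof.
move=> m0; have [A EP] := dyck_last_run P; rewrite lt0n; apply/negP => /eqP l0.
have [_] := dyck_wordP P; rewrite EP l0 walk_cat /=.
by case: walk => //= k [] /eqP; rewrite addn_eq0 andbC eqn0Ngt m0.
Qed.

Lemma last_level_suffix m (Z : dyck m) Q A : Q = A ++ word Z -> last_level Q = last_level Z.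
Proof.
by move=> ->; have [B EZ] := dyck_last_run Z; rewrite {1}EZ catA last_level_Up.
Qed.

Lemma dyck_split_last m (P : dyck m) i : (i <= last_level P)%N ->
  exists A, word P = A ++ nseq i Down.
Proof.
move=> /subnK lei; have [A EP] := dyck_last_run P.
exists (A ++ Up :: nseq (last_level P - i) Down).
by rewrite {1}EP -lei nseqD -catA /= addnK.
Qed.

Lemma word_dcat_split m (P Q : dyck m) i A : (i <= last_level P)%N ->
  word P = A ++ nseq i Down -> word (dcat P i Q) = A ++ word Q ++ nseq i Down.
Proof.
move=> lei EP; have [B [EB EW]] := wcatE Q lei; rewrite word_dcat // EW.
have szAB : size A = size B.
  by have := congr1 size EB; rewrite EP !size_cat => /addIn.
by move/eqP: EB; rewrite EP eqseq_cat // => /andP[/eqP-> _].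
Qed.

(** Both sides insert [Z] before the last [b] steps of [Y], and [R] before the last
    [c] steps of that copy of [Z]; the [b] steps of [Y] follow, hence [c + b]. *)
Lemma dcatA m (Y Z R : dyck m) b c : (b <= last_level Y)%N -> (c <= last_level Z)%N ->
  dcat Y b (dcat Z c R) = dcat (dcat Y b Z) (c + b) R.
Proof.
move=> leb lec; have [A EY] := dyck_split_last leb; have [B EZ] := dyck_split_last lec.
have EYZ := word_dcat_split Z leb EY.
apply: val_inj; rewrite /= (word_dcat_split _ leb EY) (word_dcat_split _ lec EZ).
rewrite (@word_dcat_split _ _ _ _ (A ++ B)).
- by rewrite nseqD -!catA.
- by rewrite last_level_dcat // leq_add2r.
- by rewrite EYZ EZ nseqD -!catA.
Qed.

Lemma walk_prefix m h w k u v : walk m h w = Some k -> w = u ++ v ->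
  exists j, walk m h u = Some j.
Proof. by move=> + Ew; rewrite Ew walk_cat; case: walk => // j _; exists j. Qed.

(** Otherwise [Z] would factor at that return to the axis. *)
Lemma prime_prefix m (Z : dyck m) u v : is_prime Z -> word Z = u ++ v ->
  u != [::] -> v != [::] -> walk m 0 u != Some 0%N.
Proof.
move=> pZ EZ u0 v0; apply/eqP => wu; have [_ wZ] := dyck_wordP Z.
have wv : walk m 0 v = Some 0%N by move: wZ; rewrite EZ walk_cat wu.
have Pu : (0 < nup u)%N && is_dyck m (nup u) u.
  by rewrite is_dyck_nup wu eqxx (walk_nup wu).
have Pv : (0 < nup v)%N && is_dyck m (nup v) v.
  by rewrite is_dyck_nup wv eqxx (walk_nup wv).
by case: (pZ (Dyck Pu) (Dyck Pv)); apply: val_inj; rewrite /= word_dcat0.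
Qed.

(** Write [Z = A d^c].  By primality of [Z] the path [A R d^c] does not touch the
    axis inside [A]; it stays at height at least [c > 0] along [R], and at positive
    height along [d^c] before the end. *)
Lemma prime_dcat m (Z R : dyck m) c : is_prime Z -> (0 < c <= last_level Z)%N ->
  is_prime (dcat Z c R).
Proof.
move=> pZ /andP[c0 lec] U V /(congr1 (@word m)).
have [A EZ] := dyck_split_last lec.
rewrite (word_dcat_split _ lec EZ) word_dcat0 => E.
have [[_ wZ] [_ wR]] := (dyck_wordP Z, dyck_wordP R).
have [[U0 wU] [V0 wV]] := (dyck_wordP U, dyck_wordP V).
have wA : walk m 0 A = Some c.
  have [j wA] := walk_prefix wZ EZ; move: wZ; rewrite EZ walk_cat wA /= walk_Down.
  by case: leqP => // lecj -[]; move=> /eqP; rewrite subn_eq0 => lejc;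
    congr Some; apply/eqP; rewrite eqn_leq lejc.
have [leUA|ltAU] := leqP (size U) (size A).
  have EU : word U = take (size U) A.
    by have := congr1 (take (size U)) E; rewrite takel_cat // take_size_cat.
  have EZ' : word Z = word U ++ (drop (size U) A ++ nseq c Down).
    by rewrite EZ {1}EU catA cat_take_drop.
  suff v0 : drop (size U) A ++ nseq c Down != [::].
    by have := prime_prefix pZ EZ' (word_neq0 U) v0; rewrite wU.
  by rewrite -size_eq0 size_cat size_nseq -lt0n addn_gt0 c0 orbT.
have {ltAU} [U' EU] : exists U', word U = A ++ U'.
  exists (drop (size A) U); have := congr1 (take (size A)) E.
  by rewrite take_size_cat // takel_cat 1?ltnW // => {1}->; rewrite cat_take_drop.
move/eqP: E; rewrite EU -!catA eqseq_cat // eqxx /= => /eqP E.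
have [leUR|ltRU] := leqP (size U') (size R).
  have ER : word R = U' ++ drop (size U') R.
    rewrite -{1}(cat_take_drop (size U') R); congr (_ ++ _).
    by have := congr1 (take (size U')) E; rewrite takel_cat // take_size_cat.
  have [j wU'] := walk_prefix wR ER.
  move: wU; rewrite EU walk_cat wA /= -[c]addn0 (walk_addl c wU').
  by case=> /eqP; rewrite addn_eq0 eqn0Ngt c0.
have EV : exists i, word V = nseq i Down.
  have := congr1 (drop (size U')) E; rewrite drop_cat ltnNge (ltnW ltRU) /=.
  by rewrite drop_size_cat // drop_nseq => <-; eexists.
by case: EV V0 => i ->; rewrite nup_Down.
Qed.

(** [P *_lam Q] in terms of the tail sums of [lam] and the prime factors of [Q]. *)
Fixpoint insert m (P : dyck m) (a : seq nat) (Qs : seq (dyck m)) : dyck m :=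
  if Qs is Q :: Qs' then insert (dcat P (head 0%N a) Q) (behead a) Qs' else P.

Lemma insert_factors_gaps m (P : dyck m) L a Qs : size a = size Qs -> path geq L a ->
  insert_factors P (behead (gaps L a)) Qs = insert P a Qs.
Proof.
elim: Qs P L a => [|Q Qs IH] P L [|x a] //= [sza] /andP[_ pa].
by rewrite sumn_gaps // (IH _ x).
Qed.

Lemma insert_cat m (P : dyck m) a1 a2 Qs1 Qs2 : size a1 = size Qs1 ->
  insert P (a1 ++ a2) (Qs1 ++ Qs2) = insert (insert P a1 Qs1) a2 Qs2.
Proof. by elim: Qs1 P a1 => [|Q Qs IH] P [|x a] //= [/IH->]. Qed.

(** Concatenating with [Q] at index [x] leaves a last run of length at least [x], so
    that decreasing indices stay admissible along the iteration. *)
Lemma path_geq_weaken k l a : (k <= l)%N -> path geq k a -> path geq l a.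
Proof. by case: a => //= x a lekl /andP[lex ->]; rewrite (leq_trans lex). Qed.

Lemma last_level_insert m (P : dyck m) a Qs : path geq (last_level P) a ->
  size a = size Qs -> (last (last_level P) a <= last_level (insert P a Qs))%N.
Proof.
elim: Qs P a => [|Q Qs IH] P [|x a] //= /andP[lex pa] [sza].
have := IH (dcat P x Q) a; rewrite last_level_dcat // => H.
apply: leq_trans (H _ sza); last by apply: path_geq_weaken pa; rewrite leq_addl.
by case: (a) => //=; rewrite leq_addl.
Qed.

Lemma word_insert_suffix m (Q Z : dyck m) A c Rs : word Q = A ++ word Z ->
  path geq (last_level Z) c -> size c = size Rs ->
  word (insert Q c Rs) = A ++ word (insert Z c Rs).
Proof.
elim: Rs Q Z c => [|R Rs IH] Q Z [|x c] //= EQ /andP[lex pc] [szc].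
have [B EZ] := dyck_split_last lex.
apply: IH => //; last first.
  by rewrite last_level_dcat //; apply: path_geq_weaken pc; rewrite leq_addl.
rewrite (word_dcat_split _ lex EZ) (@word_dcat_split _ _ _ _ (A ++ B)) ?catA //.
- by rewrite (last_level_suffix EQ).
- by rewrite EQ EZ catA.
Qed.

Lemma word_insert_nseq0 m (P : dyck m) Rs k : size Rs = k ->
  word (insert P (nseq k 0%N) Rs) = word P ++ flatten (map (@word m) Rs).
Proof.
move=> <-; elim: Rs P => [|R Rs IH] P /=; first by rewrite cats0.
by rewrite IH word_dcat0 catA.
Qed.

Lemma prime_insert m (Z : dyck m) c Rs : is_prime Z -> all (leq 1) c ->
  path geq (last_level Z) c -> size c = size Rs -> is_prime (insert Z c Rs).
Proof.
elim: Rs Z c => [|R Rs IH] Z [|x c] //= pZ /andP[x0 c0] /andP[lex pc] [szc].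
apply: IH => //; first by apply: prime_dcat; rewrite ?x0.
by rewrite last_level_dcat //; apply: path_geq_weaken pc; rewrite leq_addl.
Qed.

Lemma dcat_insert m (Y Z : dyck m) b c Rs : (b <= last_level Y)%N ->
  path geq (last_level Z) c -> size c = size Rs ->
  dcat Y b (insert Z c Rs) = insert (dcat Y b Z) [seq (x + b)%N | x <- c] Rs.
Proof.
move=> leb; elim: Rs Z c => [|R Rs IH] Z [|x c] //= /andP[lex pc] [szc].
rewrite IH ?dcatA // last_level_dcat //.
by apply: path_geq_weaken pc; rewrite leq_addl.
Qed.

Lemma prime_factorizationP m (P : dyck m) s : Defs.prime_decomp P s <->
  [/\ forall Q, Q \in s -> is_prime Q, s != [::] & flatten (map (@word m) s) = word P].
Proof.
split=> [[ps]|[ps s0 Es]]; last first.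
  split=> //; case: s s0 Es {ps} => // Q s _ Es.
  by apply: val_inj; rewrite /= word_foldl.
by case: s ps => // Q s ps <-; rewrite word_foldl.
Qed.

Lemma prime_factors_rcons m (Q : dyck m) : exists Qs Z,
  [/\ prime_factors Q = rcons Qs Z, is_prime Z
    & word Q = flatten (map (@word m) Qs) ++ word Z].
Proof.
have /prime_factorizationP[ps s0 EQ] := prime_factorsP Q.
case/lastP: (prime_factors Q) ps s0 EQ => // Qs Z ps _ EQ; exists Qs, Z; split=> //.
  by apply: ps; rewrite mem_rcons mem_head.
by rewrite -EQ map_rcons -cats1 flatten_cat /= cats0.
Qed.

(** A weakly decreasing sequence ends with its zeros. *)
Lemma descent_zeros l c : path geq l c ->
  c = [seq x <- c | x != 0%N] ++ nseq (num_zeros c) 0%N.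
Proof.
elim: c l => //= x c IH l /andP[_ pc]; rewrite /num_zeros /=.
case: eqVneq => [x0|_] /=; last by congr cons; apply: IH pc.
suff -> : c = nseq (size c) 0%N by rewrite filter_nseq count_nseq /= x0 mul1n.
apply/all_pred1P; move: pc; rewrite x0 => pc.
have := order_path_min (rev_trans leq_trans) pc.
by apply: sub_all => y /=; rewrite leqn0.
Qed.

Lemma size_nonzeros c : size [seq x <- c | x != 0%N] = (size c - num_zeros c)%N.
Proof.
have := count_predC (pred1 0%N) c; rewrite size_filter -/(num_zeros c) => <-.
by rewrite addKn.
Qed.

(** Insertions at positive indices happen inside the last prime factor [Z] of [Q],
    which stays prime; insertions at index 0 append new prime factors. *)
Lemma prime_factors_insert m (Q Z : dyck m) Qs c Rs :
  prime_factors Q = rcons Qs Z -> path geq (last_level Q) c -> size c = size Rs ->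
  (forall R, R \in Rs -> is_prime R) ->
  let t := (size c - num_zeros c)%N in
  prime_factors (insert Q c Rs) =
  Qs ++ insert Z [seq x <- c | x != 0%N] (take t Rs) :: drop t Rs.
Proof.
move=> EQs pc szc pR t; apply: Defs.prime_decomp_unique (prime_factorsP _) _.
have /prime_factorizationP[ps _ EQ] := prime_factorsP Q.
rewrite {}EQs in ps EQ; rewrite map_rcons -cats1 flatten_cat /= cats0 in EQ.
have Ec := descent_zeros pc.
have lLQ := last_level_suffix (esym EQ); rewrite lLQ in pc.
have szp : size [seq x <- c | x != 0%N] = size (take t Rs).
  by rewrite size_nonzeros size_takel // -szc leq_subr.
have pcp : path geq (last_level Z) [seq x <- c | x != 0%N].
  by move: pc; rewrite {1}Ec cat_path => /andP[].
apply/prime_factorizationP; split.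
- move=> U; rewrite mem_cat inE => /or3P[UQs|/eqP->|UR].
  + by apply: ps; rewrite mem_rcons inE UQs orbT.
  + apply: prime_insert => //; first by apply: ps; rewrite mem_rcons mem_head.
    by rewrite all_filter; apply/allP => x _ /=; rewrite lt0n implybb.
  + by apply: pR; apply: mem_drop UR.
- by case: (Qs).
rewrite (word_insert_suffix (esym EQ) pc szc) map_cat flatten_cat /=.
congr (_ ++ _); rewrite [in RHS]Ec -[in RHS](cat_take_drop t Rs) insert_cat //.
rewrite word_insert_nseq0 // size_drop -szc /t subKn //; exact: count_size.
Qed.

(** Associativity of the insertions.  With [h] the last index of [a], the factors
    inserted in [Q] at a positive index [x] end up at index [x + h], inside the
    copy of [Q], while those appended to [Q] are then inserted
    in the last steps of [P], at the indices listed in [b]. *)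
Lemma insert_insert m (P Q : dyck m) a c b Rs :
  path geq (last_level P) a -> size a = size (prime_factors Q) ->
  path geq (last_level Q) c -> size c = size Rs ->
  (forall R, R \in Rs -> is_prime R) ->
  insert P (a ++ b) (prime_factors (insert Q c Rs)) =
  insert (insert P a (prime_factors Q)) (raise (last (last_level P) a) c ++ b) Rs.
Proof.
move=> pa sza pc szc pR; have [Qs [Z [EQs pZ EQ]]] := prime_factors_rcons Q.
rewrite (prime_factors_insert EQs pc szc pR) EQs /= in sza *.
set t := (_ - _)%N; have Ec := descent_zeros pc.
rewrite (last_level_suffix EQ) in pc.
have szp : size [seq x <- c | x != 0%N] = size (take t Rs).
  by rewrite size_nonzeros size_takel // -szc leq_subr.
have pcp : path geq (last_level Z) [seq x <- c | x != 0%N].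
  by move: pc; rewrite {1}Ec cat_path => /andP[].
case/lastP: a pa sza => [|a h]; first by rewrite size_rcons.
rewrite rcons_path last_rcons !size_rcons => /andP[pa leh] [sza].
rewrite -!cats1 -catA !insert_cat //= dcat_insert //; last first.
  by apply: leq_trans leh _; apply: last_level_insert.
rewrite -[in RHS](cat_take_drop t Rs) insert_cat //.
by rewrite size_map.
Qed.

(** * The standard coloring as a stack *)

(** The standard coloring matches steps: the [k]-th up step pushes [m] copies of
    [k], and a down step takes the color that it pops.  After the last up step,
    the stack contains the colors of the last level, in reading order.
    [k] counts the up steps already read. *)
Fixpoint stack (m k : nat) (st : seq nat) (w : seq step) : seq nat :=
  match w with
  | [::] => st
  | Up :: w' => stack m k.+1 (nseq m k.+1 ++ st) w'
  | Down :: w' => stack m k (behead st) w'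
  end.

Fixpoint popped (m k : nat) (st : seq nat) (w : seq step) : seq nat :=
  match w with
  | [::] => [::]
  | Up :: w' => popped m k.+1 (nseq m k.+1 ++ st) w'
  | Down :: w' => head 0%N st :: popped m k (behead st) w'
  end.

Lemma stack_cat m k st a b :
  stack m k st (a ++ b) = stack m (k + nup a) (stack m k st a) b.
Proof.
elim: a k st => [|[] a IH] k st /=; rewrite ?addn0 //= IH /nup /=.
by rewrite addnA addn1.
Qed.

Lemma popped_cat m k st a b :
  popped m k st (a ++ b) = popped m k st a ++ popped m (k + nup a) (stack m k st a) b.
Proof.
elim: a k st => [|[] a IH] k st /=; rewrite ?addn0 //= IH /nup /=.
  by rewrite addnA addn1.
by rewrite add0n.
Qed.

Lemma size_popped m k st w : size (popped m k st w) = ndown w.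
Proof. by elim: w k st => [|[] w IH] k st //=; rewrite IH. Qed.

Lemma size_stack m k s w j : walk m (size s) w = Some j -> size (stack m k s w) = j.
Proof.
elim: w k s => [|[] w IH] k s /=; first by case.
  by move=> H; apply: IH; rewrite size_cat size_nseq addnC.
by case: s => //= x s; apply: IH.
Qed.

Lemma stack_extend m k s st w j : walk m (size s) w = Some j ->
  stack m k (s ++ st) w = stack m k s w ++ st /\
  popped m k (s ++ st) w = popped m k s w.
Proof.
elim: w k s => [|[] w IH] k s //=.
  by move=> H; rewrite catA; apply: IH; rewrite size_cat size_nseq addnC.
by case: s => //= x s /(IH k s)[-> ->].
Qed.

Lemma stack_shift m d k s w j : walk m (size s) w = Some j ->
  stack m (k + d) [seq (c + d)%N | c <- s] w = [seq (c + d)%N | c <- stack m k s w] /\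
  popped m (k + d) [seq (c + d)%N | c <- s] w = [seq (c + d)%N | c <- popped m k s w].
Proof.
elim: w k s => [|[] w IH] k s //=.
  move=> H; have [|E1 E2] := IH k.+1 (nseq m k.+1 ++ s).
    by rewrite size_cat size_nseq addnC.
  by rewrite -E1 -E2 map_cat map_nseq addSn.
by case: s => //= x s /(IH k s)[-> ->].
Qed.

(** A path that stays above its starting height never sees the stack it was given,
    and its colors depend on the up steps read before only by a shift. *)
Lemma stack_local m k st w j : walk m 0 w = Some j ->
  stack m k st w = [seq (c + k)%N | c <- stack m 0 [::] w] ++ st /\
  popped m k st w = [seq (c + k)%N | c <- popped m 0 [::] w].
Proof.
move=> ww; have [E1 E2] := @stack_extend m k [::] st w j ww.
have [F1 F2] := @stack_shift m k 0 [::] w j ww.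
by move: E1 E2; rewrite /= -F1 -F2.
Qed.

Lemma stack_dyck m k st w : walk m 0 w = Some 0%N -> stack m k st w = st.
Proof.
move=> ww; have [-> _] := stack_local k st ww.
by rewrite (size0nil (@size_stack m 0 [::] w 0 ww)).
Qed.

(** The recursive definition of the coloring, on the part [d P_1 d ... d P_m] read
    with the copies of color 1 of the first up step on the stack. *)
Lemma popped_pieces m (col : seq step -> seq nat) k Ps :
  (forall P, P \in Ps -> walk m 0 P = Some 0%N /\ col P = popped m 0 [::] P) ->
  popped m k (nseq (size Ps) 1%N) (flatten [seq Down :: P | P <- Ps]) =
  flatten [seq 1%N :: [seq (c + sumn [seq nup P | P <- take j Ps] + k)%N
                      | c <- col (nth [::] Ps j)] | j <- iota 0 (size Ps)].
Proof.
elim: Ps k => // P Ps IH k H.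
have [wP cP] := H P (mem_head _ _).
rewrite /= popped_cat (stack_local k (nseq (size Ps) 1%N) wP).2 stack_dyck // -cP.
congr (_ :: (_ ++ _)); first by apply: eq_map => c; rewrite addn0.
rewrite IH; last by move=> R RPs; apply: H; rewrite inE RPs orbT.
rewrite (iotaDl 1 0 (size Ps)) -map_comp; congr flatten.
apply: eq_map => j /=; congr cons; apply: eq_map => c.
by rewrite add0n; lia.
Qed.

Lemma std_coloring_popped m w : walk m 0 w = Some 0%N ->
  std_coloring m w = popped m 0 [::] w.
Proof.
have [n] := ubnP (size w); elim: n w => // n IH w; rewrite ltnS => szw ww.
have [->//|w0] := eqVneq w [::].
have dw : is_dyck m (nup w) w by rewrite is_dyck_nup ww.
have [[|P Ps] [// szPs dPs Ew]] := dyck_pieces dw w0.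
have H R : R \in P :: Ps -> walk m 0 R = Some 0%N /\ std_coloring m R = popped m 0 [::] R.
  move=> RPs; have wR : walk m 0 R = Some 0%N.
    by have := allP dPs R RPs; rewrite is_dyck_nup => /eqP.
  split=> //; apply: IH => //; apply: leq_trans szw; rewrite Ew /=.
  have EP : pieces m m (unpieces (P :: Ps)) = P :: Ps.
    by have := pieces_unpieces dPs isT; rewrite szPs.
  rewrite ltnS -[R](nth_index [::] RPs) -[X in nth _ X]EP; exact: size_pieces.
have [wP cP] := H P (mem_head _ _).
rewrite Ew std_coloringE // /color_pieces /unpieces [RHS]/= cats0.
rewrite popped_cat (stack_local 1 _ wP).2 stack_dyck //.
move: szPs => [szPs]; have -> : nseq m 1%N = nseq (size Ps) 1%N by rewrite szPs.
rewrite (popped_pieces (col := std_coloring m)); last first.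
  by move=> R RPs; apply: H; rewrite inE RPs orbT.
rewrite /= -cP; congr (_ ++ _).
  by apply: eq_map => c; rewrite addn0.
rewrite (iotaDl 1 0 (size Ps)) -map_comp; congr flatten.
apply: eq_map => j; rewrite /= add0n; congr cons; apply: eq_map => c; lia.
Qed.

Lemma stack_nseq_Down m k st i : stack m k st (nseq i Down) = drop i st.
Proof. by elim: i st => [|i IH] [|x st] //=; rewrite ?drop0 // IH; case: (i). Qed.

Lemma popped_nseq_Down m k st l : size st = l -> popped m k st (nseq l Down) = st.
Proof. by move=> <-; elim: st => //= x st ->. Qed.

Lemma size_down_levels k w : size (down_levels k w) = ndown w.
Proof. by elim: w k => [|[] w IH] k //=; rewrite IH. Qed.

(** After the last up step only down steps remain, and they empty the stack. *)
Lemma last_colors_stack m A l : walk m 0 (A ++ Up :: nseq l Down) = Some 0%N ->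
  last_colors m (A ++ Up :: nseq l Down) = stack m 0 [::] (A ++ [:: Up]) /\
  size (stack m 0 [::] (A ++ [:: Up])) = l.
Proof.
move=> ww; have [h wA] : exists h, walk m 0 (A ++ [:: Up]) = Some h.
  by move: ww; rewrite !walk_cat; case: (walk m 0 A) => //= h _; eexists.
have szS : size (stack m 0 [::] (A ++ [:: Up])) = l.
  rewrite (@size_stack m 0 [::] _ h wA); move: ww.
  rewrite -cat1s catA walk_cat wA /= walk_Down; case: leqP => // lelh [] /eqP.
  by rewrite subn_eq0 => lehl; apply/eqP; rewrite eqn_leq lehl.
split=> //; rewrite /last_colors std_coloring_popped //.
have n1 : nup (A ++ Up :: nseq l Down) = nup (A ++ [:: Up]).
  by rewrite !nup_cat /nup /= count_nseq.
rewrite n1; have -> : A ++ Up :: nseq l Down = (A ++ [:: Up]) ++ nseq l Down by rewrite -catA.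
rewrite popped_cat down_levels_cat add0n popped_nseq_Down //.
rewrite down_levels_Down zip_cat; last first.
  by rewrite size_popped size_down_levels.
rewrite filter_cat map_cat [X in map _ X ++ _](_ : _ = [::]) /=.
  rewrite (_ : [seq p <- _ | _] = zip (stack m 0 [::] (A ++ [:: Up])) (nseq l (nup (A ++ [:: Up])))).
    by rewrite -/unzip1 unzip1_zip // size_nseq szS.
  apply/all_filterP/allP => -[x y] /(map_f snd); rewrite -/unzip2 unzip2_zip ?size_nseq ?szS //.
  by move=> /nseqP[-> _] /=.
apply/eqP; rewrite -size_eq0 size_filter eqn0Ngt -has_count; apply/hasP => -[[x y] + /= /eqP].
move=> /(map_f snd); rewrite -/unzip2 unzip2_zip; last first.
  by rewrite size_popped size_down_levels.
rewrite down_levels_cat /= cats0 => /(allP (down_levels_le 0 A)) /=.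
by move=> + Ey; rewrite Ey nup_cat addn1 ltnn.
Qed.

(** * Colors of the last level and their multiplicities *)

Lemma dyck_stack m (P : dyck m) : exists A,
  [/\ word P = A ++ Up :: nseq (last_level P) Down,
      walk m 0 (A ++ [:: Up]) = Some (last_level P),
      last_colors m P = stack m 0 [::] (A ++ [:: Up])
    & size (last_colors m P) = last_level P].
Proof.
have [_ wP] := dyck_wordP P; have [A EP] := dyck_last_run P.
have := @last_colors_stack m A (last_level P); rewrite -EP => /(_ wP)[EL szL].
exists A; split; rewrite ?EL //; move: wP (szL).
rewrite EP -[Up :: nseq _ _]cat1s catA walk_cat.
by case E : (walk m 0 (A ++ [:: Up])) => [h|] // _; rewrite (@size_stack m 0 [::] _ h E) => ->.
Qed.

Lemma size_last_colors m (P : dyck m) : size (last_colors m P) = last_level P.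
Proof. by have [A []] := dyck_stack P. Qed.

(** Inserting [Q] before the last [a] steps of [P] keeps the colors of those steps,
    since the up steps of [P] all come before [Q], and shifts the colors of [Q] by
    the size of [P]. *)
Lemma last_colors_dcat m (P Q : dyck m) a : (a <= last_level P)%N ->
  last_colors m (dcat P a Q) =
  [seq (c + nup P)%N | c <- last_colors m Q] ++
  drop (last_level P - a) (last_colors m P).
Proof.
move=> lea; have [A [EP wA LA _]] := dyck_stack P; have [B [EQ wB LB _]] := dyck_stack Q.
set i := (last_level P - a)%N.
have EPa : word P = (A ++ Up :: nseq i Down) ++ nseq a Down.
  by rewrite {1}EP -{1}(subnK lea) nseqD -catA.
have EW : word (dcat P a Q) =
    ((A ++ [:: Up]) ++ nseq i Down ++ B) ++ Up :: nseq (last_level Q + a) Down.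
  by rewrite (word_dcat_split _ lea EPa) {1}EQ nseqD -!catA.
have := @last_colors_stack m _ _ (etrans (congr1 (walk m 0) (esym EW)) (dyck_wordP (dcat P a Q)).2).
rewrite -EW => -[-> _]; rewrite -!catA catA.
rewrite (stack_cat _ _ _ (A ++ [:: Up])) -LA (stack_cat _ _ _ (nseq i Down)) stack_nseq_Down.
rewrite (stack_local _ _ wB).1 -LB; congr (map _ _ ++ _).
rewrite nup_Down addn0 add0n.
by rewrite [in RHS]EP !nup_cat /nup /= count_nseq.
Qed.

Lemma last_colors_suffix m (Q Z : dyck m) A : walk m 0 A = Some 0%N ->
  word Q = A ++ word Z ->
  last_colors m Q = [seq (c + nup A)%N | c <- last_colors m Z].
Proof.
move=> wA EQ; have [B [EZ wB LB _]] := dyck_stack Z.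
have EQ' : word Q = (A ++ B) ++ Up :: nseq (last_level Z) Down by rewrite EQ {1}EZ catA.
have := @last_colors_stack m _ _ (etrans (congr1 (walk m 0) (esym EQ')) (dyck_wordP Q).2).
rewrite -EQ' => -[-> _]; rewrite -catA stack_cat (stack_dyck _ _ wA).
by rewrite (stack_local _ _ wB).1 -LB cats0.
Qed.

Lemma stack_bounds m k st w :
  all (fun c => 0 < c <= k)%N st -> (forall c, count_mem c st <= m)%N ->
  all (fun c => 0 < c <= k + nup w)%N (stack m k st w) /\
  (forall c, count_mem c (stack m k st w) <= m)%N.
Proof.
elim: w k st => [|[] w IH] k st /= Hc Hm; first by rewrite addn0.
- have -> : (k + nup (Up :: w) = k.+1 + nup w)%N by rewrite /nup /= addnA addn1.
  apply: IH => [|c].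
    rewrite all_cat all_nseq /= leqnn orbT; apply: sub_all Hc => c /andP[-> lec] /=.
    exact: leqW.
  rewrite count_cat count_nseq /=; case: eqVneq => [<-|_]; last by rewrite mul0n Hm.
  rewrite mul1n (_ : count _ _ = 0%N) ?addn0 //.
  apply/eqP; rewrite eqn0Ngt -has_count; apply/hasP => -[j /(allP Hc) + /= /eqP Ej].
  by rewrite Ej ltnn andbF.
- have -> : (k + nup (Down :: w) = k + nup w)%N by [].
  case: st Hc Hm => [|x st] /= Hc Hm; apply: IH => //; first by case/andP: Hc.
  by move=> c; apply: leq_trans (Hm c); rewrite leq_addl.
Qed.

Lemma last_colors_bounds m (P : dyck m) :
  all (fun c => 0 < c <= nup P)%N (last_colors m P) /\
  (forall c, count_mem c (last_colors m P) <= m)%N.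
Proof.
have [A [EP _ -> _]] := dyck_stack P.
have -> : nup P = (0 + nup (A ++ [:: Up]))%N.
  by rewrite EP !nup_cat /nup /= count_nseq.
by apply: stack_bounds.
Qed.

Definition max_mult (v : seq nat) : nat := \max_(c <- v) count_mem c v.

Lemma max_mult_leP v i : reflect (forall c, count_mem c v <= i)%N (max_mult v <= i)%N.
Proof.
apply: (iffP idP) => [/bigmax_leqP_seq H c|H]; last by apply/bigmax_leqP_seq => c _ _.
have [cv|] := boolP (c \in v); first exact: H.
by move=> /count_memPn->.
Qed.

Lemma leq_max_mult v c : (count_mem c v <= max_mult v)%N.
Proof. by move: c; apply/max_mult_leP. Qed.

Lemma max_mult_gt0 v : (0 < size v)%N -> (0 < max_mult v)%N.
Proof.
by case: v => // x v _; apply: leq_trans (leq_max_mult _ x); rewrite /= eqxx.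
Qed.

Lemma max_mult_map (f : nat -> nat) v : injective f -> max_mult (map f v) = max_mult v.
Proof.
move=> f_inj; rewrite /max_mult big_map; apply: eq_bigr => c _.
by rewrite count_map; apply: eq_count => x /=; rewrite (inj_eq f_inj).
Qed.

Lemma max_mult_cat u v : (forall c, c \in u -> c \notin v) ->
  max_mult (u ++ v) = maxn (max_mult u) (max_mult v).
Proof.
move=> dis; apply/eqP; rewrite eqn_leq geq_max; apply/and3P; split.
- apply/max_mult_leP => c; rewrite count_cat leq_max.
  have [cu|] := boolP (c \in u).
    by rewrite [count_mem c v](count_memPn (dis _ cu)) addn0 leq_max_mult.
  by move=> /count_memPn->; rewrite add0n leq_max_mult orbT.
- apply/max_mult_leP => c; apply: leq_trans (leq_max_mult _ c).
  by rewrite count_cat leq_addr.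
- apply/max_mult_leP => c; apply: leq_trans (leq_max_mult _ c).
  by rewrite count_cat leq_addl.
Qed.

(** For [i = 0] and [v] empty, it is [0 < n] that provides a color with multiplicity 0. *)
Lemma max_mult_eqE n v i : (0 < n)%N -> all (fun c => 0 < c <= n)%N v ->
  (all (fun c => count_mem c v <= i)%N v &&
   has (fun c => count_mem c v == i) (iota 1 n)) = (max_mult v == i).
Proof.
move=> n0 Hv; apply/andP/eqP => [[Hle /hasP[c _ /eqP Hc]]|<-].
  apply/eqP; rewrite eqn_leq -{2}Hc leq_max_mult andbT.
  by apply/bigmax_leqP_seq => d dv _; apply: (allP Hle).
split; first by apply/allP => c _; apply: leq_max_mult.
have [v0|/max_mult_gt0 mv] := posnP (size v).
  by rewrite (size0nil v0) /max_mult big_nil; apply/hasP; exists 1%N; rewrite ?mem_iota.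
have /hasP[c cv Hc] : has (fun c => count_mem c v == max_mult v) v.
  apply: contraT => /hasPn Hn; suff : (max_mult v <= (max_mult v).-1)%N by lia.
  apply/bigmax_leqP_seq => c cv _; have := Hn c cv; have := leq_max_mult v c; lia.
by apply/hasP; exists c => //; rewrite mem_iota add1n ltnS; apply: (allP Hv).
Qed.

(** A sequence [lam] belongs to [Lambda_r^i(P)] when [mult P lam_r] is [i]. *)
Definition mult m (P : dyck m) (a : nat) : nat :=
  max_mult (drop (last_level P - a) (last_colors m P)).

Lemma mult0 m (P : dyck m) : mult P 0 = 0%N.
Proof. by rewrite /mult subn0 drop_oversize ?size_last_colors // /max_mult big_nil. Qed.

Lemma mult_gt0 m (P : dyck m) a : (0 < a <= last_level P)%N -> (0 < mult P a)%N.
Proof.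
by move=> /andP[a0 lea]; apply: max_mult_gt0; rewrite size_drop size_last_colors subKn.
Qed.

Lemma mult_le m (P : dyck m) a : (mult P a <= m)%N.
Proof.
apply/max_mult_leP => c; apply: leq_trans ((last_colors_bounds P).2 c).
by rewrite -[X in (_ <= count _ X)%N](cat_take_drop (last_level P - a)) count_cat leq_addl.
Qed.

Lemma mult_mono m (P : dyck m) a b : (a <= b)%N -> (mult P a <= mult P b)%N.
Proof.
move=> leab; apply/max_mult_leP => c; apply: leq_trans (leq_max_mult _ c).
have -> : (last_level P - a = (b - a - (b - last_level P)) + (last_level P - b))%N by lia.
rewrite -drop_drop.
by rewrite -[X in (_ <= count _ X)%N](cat_take_drop (b - a - (b - last_level P))) count_cat leq_addl.
Qed.

Lemma Lambda_condE m (P : dyck m) a i :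
  (let omega := last_colors m P in
   let v := drop (size omega - a) omega in
   all (fun c => count_mem c v <= i)%N v &&
   has (fun c => count_mem c v == i) (iota 1 (nup P))) = (mult P a == i).
Proof.
rewrite /= size_last_colors; apply: max_mult_eqE; first exact: (dyck_wordP P).1.
by apply/allP => c /mem_drop; apply: (allP (last_colors_bounds P).1).
Qed.

(** All insertions take place at indices [x >= h], hence before the last [h] steps. *)
Lemma lowest_colors_insert m (P : dyck m) a Qs h : path geq (last_level P) a ->
  size a = size Qs -> (h <= last (last_level P) a)%N ->
  drop (last_level (insert P a Qs) - h) (last_colors m (insert P a Qs)) =
  drop (last_level P - h) (last_colors m P).
Proof.
elim: Qs P a => [|Q Qs IH] P [|x a] //= /andP[lex pa] [sza] leh.
have lehx : (h <= x)%N.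
  apply: leq_trans leh _; case/lastP: a pa {sza} => // a y.
  rewrite last_rcons => pa; have := order_path_min (rev_trans leq_trans) pa.
  by move=> /allP/(_ y); rewrite mem_rcons mem_head; apply.
rewrite IH ?last_level_dcat //; last 2 first.
- by apply: path_geq_weaken pa; rewrite leq_addl.
- by apply: leq_trans leh _; case: (a) => //=; rewrite leq_addl.
rewrite last_colors_dcat // drop_cat size_map size_last_colors ltnNge.
rewrite -addnBA // leq_addr /= addKn drop_drop.
by congr drop; lia.
Qed.

Lemma walk_flatten m (Qs : seq (dyck m)) : walk m 0 (flatten (map (@word m) Qs)) = Some 0%N.
Proof. by elim: Qs => //= Q Qs IH; rewrite walk_cat (dyck_wordP Q).2. Qed.

Lemma mult_insert_low m (P : dyck m) a Qs b : path geq (last_level P) a ->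
  size a = size Qs -> (b <= last (last_level P) a)%N ->
  mult (insert P a Qs) b = mult P b.
Proof. by move=> pa sza leb; rewrite /mult lowest_colors_insert. Qed.

(** The last level of [P *_lam Q] consists of the last level of [Q], recolored
    injectively, and the last [h] steps of [P]; the recoloring is by a shift [d] that
    exceeds the colors of these steps.  The colors [e] are those of the last
    prime factor of [Q], which differ from those of [Q] by a shift [d']. *)
Lemma last_colors_insert_star m (P Q : dyck m) a : path geq (last_level P) a ->
  size a = size (prime_factors Q) ->
  let h := last (last_level P) a in
  exists d e, [/\ last_level (insert P a (prime_factors Q)) = (last_level Q + h)%N,
     last_colors m (insert P a (prime_factors Q)) =
     [seq (c + d)%N | c <- e] ++ drop (last_level P - h) (last_colors m P),
     (exists d', last_colors m Q = [seq (c + d')%N | c <- e]) &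
     all (fun c => 0 < c)%N e /\
     all (fun c => c <= d)%N (drop (last_level P - h) (last_colors m P))].
Proof.
move=> pa sza; have [Qs [Z [EQs pZ EQ]]] := prime_factors_rcons Q.
rewrite EQs in sza *; case/lastP: a pa sza => [|a h]; first by rewrite size_rcons.
rewrite rcons_path !size_rcons last_rcons => /andP[pa leh] [sza] /=.
have lehY := leq_trans leh (last_level_insert pa sza).
rewrite -!cats1 insert_cat //= last_level_dcat // last_colors_dcat //.
rewrite lowest_colors_insert //; exists (nup (insert P a Qs)), (last_colors m Z).
split=> //.
- by rewrite (last_level_suffix EQ).
- by eexists; apply: last_colors_suffix EQ; apply: walk_flatten.
split; first by apply: sub_all (last_colors_bounds Z).1 => c /andP[].
rewrite -(lowest_colors_insert pa sza leh); apply/allP => c /mem_drop.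
by move=> /(allP (last_colors_bounds _).1) /andP[].
Qed.

(** The colors of the inserted path and of [P] are disjoint, so multiplicities do
    not add up: the maximum of each part counts. *)
Lemma mult_insert_high m (P Q : dyck m) a c : path geq (last_level P) a ->
  size a = size (prime_factors Q) -> (c <= last_level Q)%N ->
  mult (insert P a (prime_factors Q)) (c + last (last_level P) a) =
  maxn (mult Q c) (mult P (last (last_level P) a)).
Proof.
move=> pa sza lec; have [d [e [EL EC [d' EQ] [e0 ed]]]] := last_colors_insert_star pa sza.
have sze : size e = last_level Q by rewrite -size_last_colors EQ size_map.
rewrite /mult EL EC subnDr drop_cat size_map sze.
rewrite (_ : (if _ then _ else _) = drop (last_level Q - c) [seq (x + d)%N | x <- e] ++
   drop (last_level P - last (last_level P) a) (last_colors m P)); last first.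
  case: ltnP => // leL.
  by rewrite [X in _ = X ++ _]drop_oversize ?size_map ?sze // (_ : (_ - _ - _ = 0)%N) ?drop0 //; lia.
rewrite max_mult_cat; last first.
  move=> x /mem_drop /mapP[y ye ->]; apply/negP => /(allP ed).
  by have := allP e0 y ye; lia.
congr maxn; rewrite EQ -!map_drop !max_mult_map // => x y; exact: addIn.
Qed.

(** * Linear and bilinear extension *)

Definition lin_ext (K : fieldType) (T : choiceType) (V : lmodType K) (f : T -> V)
    (x : {malg K[T]}) : V :=
  \sum_(P <- msupp x) x@_P *: f P.

Lemma lin_extEw (K : fieldType) (T : choiceType) (V : lmodType K) (f : T -> V)
    (x : {malg K[T]}) (D : {fset T}) : (msupp x `<=` D)%fset ->
  lin_ext f x = \sum_(P <- D) x@_P *: f P.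
Proof.
move=> sD; rewrite /lin_ext; apply: big_fset_incl => // P _ Px.
by rewrite mcoeff_outdom // scale0r.
Qed.

Lemma lin_ext_is_linear (K : fieldType) (T : choiceType) (V : lmodType K) (f : T -> V) :
  linear (lin_ext f).
Proof.
move=> c x y; pose D := (msupp x `|` (msupp y `|` msupp (c *: x + y)))%fset.
have sx : (msupp x `<=` D)%fset by apply: fsubsetUl.
have sy : (msupp y `<=` D)%fset by apply: fsubsetU; rewrite fsubsetUl orbT.
have sz : (msupp (c *: x + y) `<=` D)%fset by apply: fsubsetU; rewrite fsubsetUr orbT.
rewrite (lin_extEw f sx) (lin_extEw f sy) (lin_extEw f sz).
rewrite scaler_sumr -big_split /=; apply: eq_bigr => P _.
by rewrite mcoeffD mcoeffZ scalerDl scalerA.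
Qed.

HB.instance Definition _ (K : fieldType) (T : choiceType) (V : lmodType K) (f : T -> V) :=
  GRing.isLinear.Build K {malg K[T]} V _ (lin_ext f) (lin_ext_is_linear f).

Lemma lin_extU (K : fieldType) (T : choiceType) (V : lmodType K) (f : T -> V) P :
  lin_ext f << P >> = f P.
Proof.
by rewrite (lin_extEw f (msuppU_le (k := P) (x := 1))) big_seq_fset1 mcoeffUU scale1r.
Qed.

Lemma eq_lin_ext (K : fieldType) (T : choiceType) (V : lmodType K) (f g : T -> V) x :
  f =1 g -> lin_ext f x = lin_ext g x.
Proof. by move=> fg; apply: eq_bigr => P _; rewrite fg. Qed.

Lemma linear_lin_ext (K : fieldType) (T : choiceType) (V W : lmodType K)
    (h : {linear V -> W}) (f : T -> V) x :
  h (lin_ext f x) = lin_ext (h \o f) x.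
Proof. by rewrite /lin_ext linear_sum; apply: eq_bigr => P _; rewrite linearZ. Qed.

Definition bilin_ext (K : fieldType) (T : choiceType) (V : lmodType K)
    (f : T -> T -> V) (x y : {malg K[T]}) : V :=
  lin_ext (fun P => lin_ext (f P) y) x.

Lemma bilin_extC (K : fieldType) (T : choiceType) (V : lmodType K)
    (f : T -> T -> V) (x y : {malg K[T]}) :
  bilin_ext f x y = lin_ext (fun Q => lin_ext (f^~ Q) x) y.
Proof.
rewrite /bilin_ext /lin_ext; under eq_bigr => P _ do rewrite scaler_sumr.
rewrite exchange_big; apply: eq_bigr => Q _; rewrite scaler_sumr.
by apply: eq_bigr => P _; rewrite !scalerA mulrC.
Qed.

(** Reduces an identity between iterated products to basis elements. *)
Lemma bilin_ext_assoc (K : fieldType) (T : choiceType)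
    (f g k h : T -> T -> {malg K[T]}) (x y z : {malg K[T]}) :
  (forall P Q R, lin_ext (f P) (g Q R) = lin_ext (k^~ R) (h P Q)) ->
  bilin_ext f x (bilin_ext g y z) = bilin_ext k (bilin_ext h x y) z.
Proof.
move=> H.
transitivity (bilin_ext (fun P R => lin_ext (fun Q => lin_ext (f P) (g Q R)) y) x z).
  apply: eq_lin_ext => P; rewrite (bilin_extC g) linear_lin_ext.
  by apply: eq_lin_ext => R; rewrite [LHS]linear_lin_ext.
rewrite [LHS]bilin_extC [RHS]bilin_extC; apply: eq_lin_ext => R.
rewrite [RHS]linear_lin_ext; apply: eq_lin_ext => P.
rewrite [RHS]linear_lin_ext; apply: eq_lin_ext => Q; exact: H.
Qed.

Lemma starE (K : fieldType) m j (x y : {malg K[dyck m]}) :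
  star j x y = bilin_ext (@star_basis K m j) x y.
Proof.
rewrite /star /bilin_ext /lin_ext; apply: eq_bigr => P _; rewrite scaler_sumr.
by apply: eq_bigr => Q _; rewrite scalerA.
Qed.

(** * The products and their associativity *)

(** With a predicate in place of an index, a sum such as [y *_0 z + ... + y *_i z] has
    the same form as a single product, and the two families of relations become
    instances of one statement. *)
Definition star_when (K : fieldType) m (D : pred nat) (P Q : dyck m) : {malg K[dyck m]} :=
  \sum_(a <- descents (last_level P) (size (prime_factors Q)) |
        D (mult P (last (last_level P) a)))
     << insert P a (prime_factors Q) >>.

Lemma star_basisE (K : fieldType) m j (P Q : dyck m) :
  star_basis K j P Q = star_when K (pred1 j) P Q.
Proof.
rewrite /star_basis /star_when [RHS]big_seq_cond.
pose C (a : nat) := mult P a == j.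
pose F u : {malg K[dyck m]} := << insert_factors P (behead u) (prime_factors Q) >>.
have := sum_compositions (last_level P) (size (prime_factors Q)) C F.
rewrite [in RHS]big_seq_cond => E.
transitivity (\sum_(a <- descents (last_level P) (size (prime_factors Q)) |
   (a \in descents (last_level P) (size (prime_factors Q))) && C (last (last_level P) a))
     F (gaps (last_level P) a)).
  rewrite -E; apply: eq_bigl => lam.
  by rewrite inE inE Lambda_condE.
apply: eq_bigr => a /andP[]; rewrite mem_descents => /andP[/eqP sza pa] _.
by rewrite /F insert_factors_gaps.
Qed.

Lemma sum_star (K : fieldType) m (r : seq nat) (x y : {malg K[dyck m]}) : uniq r ->
  \sum_(k <- r) star k x y = bilin_ext (star_when K (mem r)) x y.
Proof.
move=> ur; under eq_bigr => k _ do rewrite starE.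
rewrite /bilin_ext /lin_ext exchange_big; apply: eq_bigr => P _.
rewrite -scaler_sumr; congr (_ *: _).
rewrite exchange_big; apply: eq_bigr => Q _.
rewrite -scaler_sumr; congr (_ *: _).
under eq_bigr => k _ do rewrite star_basisE /star_when big_mkcond.
rewrite exchange_big [RHS]big_mkcond; apply: eq_bigr => a _ /=.
set u := mult P _; case: ifPn => [ur'|nur].
  rewrite (bigD1_seq _ ur' ur) /= eqxx big1 ?addr0 // => k.
  by rewrite eq_sym => /negPf->.
rewrite big_seq big1 // => k kr; case: eqP => // uk.
by rewrite uk kr in nur.
Qed.

Lemma last_descent L a : path geq L a -> (last L a <= L)%N.
Proof.
elim: a L => //= x a IH L /andP[lex /IH le]; exact: leq_trans lex.
Qed.

Lemma size_prime_factors_insert m (Q : dyck m) c Rs :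
  path geq (last_level Q) c -> size c = size Rs ->
  (forall R, R \in Rs -> is_prime R) ->
  size (prime_factors (insert Q c Rs)) = (size (prime_factors Q) + num_zeros c)%N.
Proof.
move=> pc szc pR; have [Qs [Z [EQs _ _]]] := prime_factors_rcons Q.
have lez : (num_zeros c <= size c)%N by apply: count_size.
rewrite (prime_factors_insert EQs pc szc pR) EQs size_cat size_rcons /= size_drop -szc.
by rewrite subKn // addnS.
Qed.

(** In both members the pairs of index sequences correspond to the triples
    [(a, c, b)] of [sum_descents_split] and [insert_insert], and only the
    conditions on multiplicities have to be compared.  They are expressed by
    [u], the multiplicity for the last index [h] of [a], by [v], that for the last
    index of [c], and by [w], that for the last index of [b].  Either all
    factors of [R] go inside [Q], and then [v > 0] and [b] is empty, or the last one is
    appended, and then the multiplicity for [c] is 0 and [w <= u]. *)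
Lemma star_when_assoc (K : fieldType) m (hm : (1 <= m)%N) (D1 D2 D3 D4 : pred nat)
    (P Q R : dyck m) :
  (forall u v, u <= m -> 0 < v -> D1 u && D2 v = D3 u && D4 (maxn v u))%N ->
  (forall u w, u <= m -> w <= u -> D1 w && D2 0%N = D3 u && D4 w)%N ->
  lin_ext (star_when K D1 P) (star_when K D2 Q R) =
  lin_ext ((star_when K D4)^~ R) (star_when K D3 P Q).
Proof.
move=> Hhigh Hlow; have l0 := last_level_gt0 Q hm.
have [pR _] := prime_factorsP R.
rewrite [star_when K D2 _ _]/star_when [star_when K D3 _ _]/star_when !linear_sum.
set Qs := prime_factors Q; set Rs := prime_factors R; set l := last_level Q.
set L := last_level P.
(* the contribution of a triple to the left member *)
pose G a c b : {malg K[dyck m]} := let h := last L a in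
  if D1 (mult P (last h b)) && D2 (mult Q (last l c))
  then << insert (insert P a Qs) (raise h c ++ b) Rs >> else 0.
transitivity (\sum_(c <- descents l (size Rs)) \sum_(a <- descents L (size Qs))
    \sum_(b <- descents (last L a) (num_zeros c)) G a c b).
  rewrite big_mkcond; apply: eq_big_seq => c; rewrite mem_descents => /andP[/eqP szc pc].
  rewrite /= lin_extU /star_when (size_prime_factors_insert pc szc pR) -/L.
  rewrite big_mkcond sum_descents_cat -/Qs.
  case: ifP => D2c; last first.
    by rewrite big1 // => a _; rewrite big1 // => b _; rewrite /G D2c andbF.
  apply: eq_big_seq => a; rewrite mem_descents => /andP[/eqP sza pa].
  apply: eq_bigr => b _; rewrite /G D2c andbT last_cat.
  by case: ifP => // _; rewrite insert_insert.
rewrite exchange_big [RHS]big_mkcond; apply: eq_big_seq => a /=.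
rewrite mem_descents => /andP[/eqP sza pa].
have [d [e [EL _ _ _]]] := last_colors_insert_star pa sza.
rewrite lin_extU /star_when EL -/Rs -/L -/l; set h := last L a.
rewrite [in RHS]big_mkcond sum_descents_split.
have -> (b : bool) (x : {malg K[dyck m]}) : (if b then x else 0) = b%:R *: x.
  by case: b; rewrite ?scale1r ?scale0r.
rewrite scaler_sumr; apply: eq_big_seq => c; rewrite mem_descents => /andP[/eqP szc pc].
rewrite scaler_sumr; apply: eq_big_seq => b; rewrite mem_descents => /andP[/eqP szb pb].
rewrite /G -/h; set W := insert P a Qs.
have leb := last_descent pb; have lec := last_descent pc.
suff -> : D1 (mult P (last h b)) && D2 (mult Q (last l c)) =
    D3 (mult P h) && D4 (mult W (last (l + h)%N (raise h c ++ b))).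
  by case: (D3 _) => /=; rewrite ?scale1r ?scale0r.
(* whether the last prime factor of R is inserted inside Q or appended to it *)
have [nz0|nz] := posnP (num_zeros c).
- have {szb} -> : b = [::] by apply: size0nil; rewrite szb.
  have c0 : all (fun x => x != 0%N) c by rewrite all_predC has_count -/(num_zeros c) nz0.
  rewrite cats0 /= /raise (all_filterP c0) (last_map (fun x => x + h)%N).
  rewrite mult_insert_high //; apply: Hhigh; [exact: mult_le|apply: mult_gt0].
  rewrite lec andbT; have : last l c \in l :: c by apply: mem_last.
  by rewrite inE => /orP[/eqP->//|/(allP c0)]; rewrite lt0n.
- have -> : last l c = 0%N.
    by rewrite (descent_zeros pc); case: (num_zeros c) nz => // k _;
      rewrite last_cat /=; elim: k.
  have -> : last (l + h)%N (raise h c ++ b) = last h b.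
    by case: b szb {pb leb} => [/= E|x b _]; [rewrite -E in nz | rewrite last_cat].
  rewrite mult0 mult_insert_low //; apply: Hlow; [exact: mult_le|exact: mult_mono].
Qed.

Theorem theorem4p3p9 (K : fieldType) (m : nat) (hm : (1 <= m)%N)
    (x y z : {malg K[dyck m]}) :
  (forall i j : nat, (i < j <= m)%N ->
     star i x (star j y z) = star j (star i x y) z) /\
  (forall i : nat, (i <= m)%N ->
     star i x (\sum_(0 <= k < i.+1) star k y z) =
     star i (\sum_(i <= k < m.+1) star k x y) z).
Proof.
have star1 i (u v : {malg K[dyck m]}) : star i u v = bilin_ext (star_when K (pred1 i)) u v.
  rewrite starE; apply: eq_lin_ext => P; apply: eq_lin_ext => Q; exact: star_basisE.
split=> [i j /andP[ltij _]|i _].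
  rewrite !star1; apply: bilin_ext_assoc => P Q R.
  apply: star_when_assoc => //= [u v _ v0|u w _ leuw]; lia.
rewrite !sum_star ?iota_uniq // !star1; apply: bilin_ext_assoc => P Q R.
(* the upper bound m on the sum is harmless, as multiplicities are at most m *)
by apply: star_when_assoc => //= [u v leum v0|u w leum leuw]; rewrite !mem_index_iota; lia.
Qed.
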